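(* Let $(Z,\Omega,\mathcal L)$ be a holomorphic symplectic Morita equivalence with brane bisection. Given a generic Darboux chart $(T^*L,\Omega_0)\to(Z,\Omega)$, there is a smooth real-valued function $K\in C^\infty(L,\mathbb R)$, unique up to an additive real constant, such that $\mathcal L=\mathrm{Gr}(-i\partial K)$, the graph of the $(1,0)$-form $-i\partial K$. Furthermore, the real 2-form $F=\Omega|_{\mathcal L}$ is given by $F=i\partial\bar\partial K$. The function $K$ is called the generalized Kähler potential.
   Context: Holomorphic symplectic Morita equivalence between holomorphic Poisson manifolds $(X_-,\sigma_-)$ and $(X_+,\sigma_+)$: a holomorphic symplectic manifold $(Z,\Omega)$ with holomorphic surjective submersions $\pi_\pm:Z\to X_\pm$ with connected, simply connected fibres such that $\pi_+$ is Poisson, $\pi_-$ is anti-Poisson, the distributions $\ker d\pi_+$ and $\ker d\pi_-$ are symplectically orthogonal, and $\pi_\pm$ are complete (the pullback of any complete Hamiltonian vector field is complete). Brane bisection: a smooth submanifold $\mathcal L\subset Z$ which is Lagrangian for $\mathrm{Im}(\Omega)$ and is a section of both $\pi_+$ and $\pi_-$. Thus $\Omega|_{\mathcal L}$ is a real closed 2-form. Darboux chart: a local holomorphic symplectomorphism $(T^*L,\Omega_0)\to(Z,\Omega)$, where $L\subset Z$ is a holomorphic Lagrangian submanifold, $T^*L$ is its holomorphic cotangent bundle (identified with the bundle $T^*_{1,0}L$ of $(1,0)$-forms), and $\Omega_0$ is the canonical holomorphic symplectic form, with the convention that $\eta^*\Omega_0=d\eta$ for a $(1,0)$-form $\eta$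 viewed as a smooth section $L\to T^*L$. The chart is generic if, in the chart, $\mathcal L$ is the graph of a $(1,0)$-form $\eta\in\Omega^{1,0}(L)$. The operators $\partial,\bar\partial$ are those of the complex manifold $L$, and $F=\Omega|_{\mathcal L}$ is viewed as a 2-form on $L$ by identifying $\mathcal L$ with $L$ through this graph.
   Formalization: The base L of the Darboux chart is additionally assumed connected and simply connected; without this existence fails (L an elliptic curve, brane the graph of c dz, c ≠ 0) and, for disconnected L, so does uniqueness up to one constant. *)

(* Defs.v *)
From HB Require Import structures.
From mathcomp Require Import all_boot all_order all_algebra.
From mathcomp Require Import all_classical all_reals all_analysis.
From mathcomp Require Export complex.
Import Order.TTheory GRing.Theory Num.Theory.
Import numFieldNormedType.Exports.

Set Implicit Arguments.
Unset Strict Implicit.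
Unset Printing Implicit Defensive.

Local Open Scope classical_set_scope.
Local Open Scope ring_scope.

(** * Calculus on C^n *)

(** A point of C^n is the pair (x, y) of its real and imaginary parts, so that
    the library's topology and real differentiability apply. *)
Notation Cn R n := ('rV[R]_n * 'rV[R]_n)%type.

Section Calculus.
Context {R : realType}.

Fixpoint Ck (k : nat) (V : normedModType R) (A : set V) (f : V -> R) : Prop :=
  if k is k'.+1 then
    (forall x, A x -> differentiable f x) /\
    (forall v, Ck k' A (fun x => 'D_v f x))
  else forall x, A x -> {for x, continuous f}.

Definition smooth (V : normedModType R) (A : set V) (f : V -> R) : Prop :=
  forall k, Ck k A f.

Definition csmooth (V : normedModType R) (A : set V) (f : V -> R[i]) : Prop :=
  smooth A (fun x => complex.Re (f x)) /\ smooth A (fun x => complex.Im (f x)).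

Definition cD (V : normedModType R) (v : V) (f : V -> R[i]) (x : V) : R[i] :=
  ('D_v (fun y => complex.Re (f y)) x +i* 'D_v (fun y => complex.Im (f y)) x)%C.

Context {n : nat}.

(** [dzv v] is the row (dz_j(v))_j; it also reads a point of C^n as a complex
    row vector. *)
Definition dzv (v : Cn R n) : 'rV[R[i]]_n := \row_j (v.1 0 j +i* v.2 0 j)%C.

(** The real directions d/dx_j and d/dy_j. *)
Definition ex (j : 'I_n) : Cn R n := (delta_mx 0 j, 0).
Definition ey (j : 'I_n) : Cn R n := (0, delta_mx 0 j).

(** Wirtinger operators d/dz_j and d/dzbar_j. *)
Definition wirt (j : 'I_n) (f : Cn R n -> R[i]) (x : Cn R n) : R[i] :=
  2^-1 * (cD (ex j) f x - 'i%C * cD (ey j) f x).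
Definition wirtb (j : 'I_n) (f : Cn R n -> R[i]) (x : Cn R n) : R[i] :=
  2^-1 * (cD (ex j) f x + 'i%C * cD (ey j) f x).

End Calculus.

(** * Complex manifolds *)

Record chart (R : realType) (n : nat) (M : Type) := Chart {
  cdom : set M;
  coord : M -> Cn R n  (* meaningful on [cdom] only *)
}.

(** A space with a set of charts, not yet subject to any compatibility. *)
Structure charted (R : realType) (n : nat) := Charted {
  cspace :> topologicalType;
  atlas : set (chart R n cspace)
}.

Section Charted.
Context {R : realType} {n : nat} {M : charted R n}.
Implicit Types (c d : chart R n M) (p : M) (g : M -> R[i]) (A : set M).

(** [p] lies in the domain of the chart [c] of [M]. *)
Definition chart_at c p : Prop := atlas c /\ cdom c p.

Definition zc c (k : 'I_n) p : R[i] := dzv (coord c p) 0 k.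

(** [g] read in the chart [c], i.e. [g \o (coord c)^-1]; 0 outside the image. *)
Definition lrep c g : Cn R n -> R[i] :=
  fun y => xget 0 [set g q | q in cdom c `&` coord c @^-1` [set y]].

(** Derivatives of [g] at [p] in the coordinates of [c]. *)
Definition dv c (v : Cn R n) g p : R[i] := cD v (lrep c g) (coord c p).
Definition dz c (j : 'I_n) g p : R[i] := wirt j (lrep c g) (coord c p).
Definition dzb c (j : 'I_n) g p : R[i] := wirtb j (lrep c g) (coord c p).

(** In the next two definitions [A] is meant to be open. *)
Definition smooth_scalar A g : Prop :=
  forall c, atlas c -> csmooth (coord c @` (cdom c `&` A)) (lrep c g).

Definition holo_scalar A g : Prop :=
  smooth_scalar A g /\
  forall c p j, chart_at c p -> A p -> dzb c j g p = 0.

(** Holomorphic Jacobian of the change of coordinates from [c] to [d], acting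
    on row vectors on the right. *)
Definition trans_jac c d p : 'M[R[i]]_n := \matrix_(j, k) dz c j (zc d k) p.

End Charted.

Record complex_manifold_axioms (R : realType) (n : nat) (M : charted R n) :
    Prop := {
  cm_hausdorff : hausdorff_space M;
  cm_second_countable : @second_countable M;
  cm_cover : forall p : M, exists c, chart_at c p;
  cm_dom_open : forall c, @atlas R n M c -> open (cdom c);
  cm_img_open : forall c, @atlas R n M c -> open (coord c @` cdom c);
  cm_inj : forall c, @atlas R n M c -> set_inj (cdom c) (coord c);
  cm_homeo : forall c, @atlas R n M c ->
    forall A, A `<=` cdom c -> (open A <-> open (coord c @` A));
  cm_trans : forall c d, @atlas R n M c -> @atlas R n M d -> forall k,
    holo_scalar (cdom c `&` cdom d) (zc d k)
}.

Structure complexManifold (R : realType) (n : nat) := ComplexManifold {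
  cm_charted :> charted R n;
  cmP : complex_manifold_axioms cm_charted
}.

Section Maps.
Context {R : realType} {m n : nat} {M : charted R m} {N : charted R n}.
Implicit Types (A : set M) (f : M -> N).

Definition smooth_map A f : Prop :=
  (forall p, A p -> {for p, continuous f}) /\
  forall d, atlas d -> forall k,
    smooth_scalar (A `&` f @^-1` cdom d) (fun q => zc d k (f q)).

Definition holo_map A f : Prop :=
  (forall p, A p -> {for p, continuous f}) /\
  forall d, atlas d -> forall k,
    holo_scalar (A `&` f @^-1` cdom d) (fun q => zc d k (f q)).

(** Holomorphic Jacobian of [f]; the differential on (1,0)-vectors is
    [v |-> v *m jac]. *)
Definition jac (c : chart R m M) (d : chart R n N) f (p : M) :
    'M[R[i]]_(m, n) :=
  \matrix_(j, k) dz c j (fun q => zc d k (f q)) p.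

(** The values of the dz_k on the image of the real tangent vector [v]. *)
Definition push (c : chart R m M) (d : chart R n N) f (p : M) (v : Cn R m) :
    'rV[R[i]]_n :=
  \row_k dv c v (fun q => zc d k (f q)) p.

End Maps.

Section Iso.
Context {R : realType} {m n : nat} {M : charted R m} {N : charted R n}.

(** [f] restricts to a biholomorphism from the open set [U] onto an open set. *)
Definition open_holo_iso (U : set M) (f : M -> N) : Prop :=
  open U /\ holo_map U f /\
  exists (V : set N) (g : N -> M),
    [/\ open V, holo_map V g,
        (forall p, U p -> V (f p) /\ g (f p) = p) &
        (forall q, V q -> U (g q) /\ f (g q) = q)].

Definition holo_embedding (f : M -> N) : Prop :=
  [/\ holo_map [set: M] f, injective f,
      (forall c d p, chart_at c p -> chart_at d (f p) -> row_free (jac c d f p)) &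
      (forall A, open A -> exists2 B, open B & A = f @^-1` B)].

Definition holo_surj_submersion (f : M -> N) : Prop :=
  [/\ holo_map [set: M] f, (forall q, exists p, f p = q) &
      (forall c d p, chart_at c p -> chart_at d (f p) -> row_full (jac c d f p))].

End Iso.

(** * Curves, tangent vectors, loops *)

Section Curves.
Context {R : realType} {n : nat} {M : charted R n}.

Definition smooth_curve (J : set R) (g : R -> M) : Prop :=
  (forall t, J t -> {for t, continuous g}) /\
  forall c, atlas c -> forall k,
    csmooth (V := R^o) (J `&` g @^-1` cdom c) (fun t => zc c k (g t)).

Definition velocity (c : chart R n M) (g : R -> M) (t : R) : 'rV[R[i]]_n :=
  \row_k cD (1 : R^o) (fun s : R^o => zc c k (g s)) t.

(** Tangent vectors at [p] to an embedded submanifold [S], as velocities of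
    smooth curves in [S]; a real tangent vector is recorded by the values on it
    of the coordinate differentials dz_k of [c]. *)
Definition tangent (S : set M) (c : chart R n M) (p : M) :
    set 'rV[R[i]]_n :=
  [set v | exists (g : R -> M) (e : R),
     [/\ 0 < e, smooth_curve `]- e, e[ g,
         (forall t, t \in `]- e, e[ -> S (g t)), g 0 = p & v = velocity c g 0]].

(** [g] is an integral curve, for all real times, of the real vector field
    underlying the holomorphic one with (1,0)-components [w]. *)
Definition integral_curve (w : chart R n M -> M -> 'rV[R[i]]_n) (g : R -> M) :
    Prop :=
  (forall t, {for t, continuous g}) /\
  forall t c k, chart_at c (g t) ->
    is_derive t 1 (fun s => complex.Re (zc c k (g s)))
      (complex.Re (w c (g t) 0 k)) /\
    is_derive t 1 (fun s => complex.Im (zc c k (g s)))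
      (complex.Im (w c (g t) 0 k)).

Definition complete_field (w : chart R n M -> M -> 'rV[R[i]]_n) : Prop :=
  forall p, exists2 g, g 0 = p & integral_curve w g.

End Curves.

(** Every loop in [S] contracts in [S] relative to its base point;
    connectedness is not included. *)
Definition simply_connected (R : realType) (T : topologicalType) (S : set T) :
    Prop :=
  forall g : R -> T,
    {within `[0, 1], continuous g} -> (forall t, t \in `[0, 1] -> S (g t)) ->
    g 0 = g 1 ->
    exists H : R * R -> T,
      [/\ {within `[0, 1] `*` `[0, 1], continuous H},
          (forall s t, s \in `[0, 1] -> t \in `[0, 1] -> S (H (s, t))),
          (forall t, t \in `[0, 1] -> H (0, t) = g t /\ H (1, t) = g 0) &
          (forall s, s \in `[0, 1] -> H (s, 0) = g 0 /\ H (s, 1) = g 0)].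

(** * Holomorphic Poisson and symplectic structures *)

Section Tensors.
Context {R : realType} {n : nat} (M : charted R n).

(** A bivector or 2-form of type (2,0) given by its component matrix in each
    chart. *)
Definition tensor2 := chart R n M -> M -> 'M[R[i]]_n.

Definition form2_tensorial (W : tensor2) : Prop :=
  forall c d p, chart_at c p -> chart_at d p ->
    W c p = trans_jac c d p *m W d p *m (trans_jac c d p)^T.

Definition bivector_tensorial (s : tensor2) : Prop :=
  forall c d p, chart_at c p -> chart_at d p ->
    s d p = (trans_jac c d p)^T *m s c p *m trans_jac c d p.

Definition holo_antisym (W : tensor2) : Prop :=
  (forall c i j, atlas c -> holo_scalar (cdom c) (fun p => W c p i j)) /\
  (forall c p, chart_at c p -> (W c p)^T = - W c p).

(** W(v, w) = v W w^T, that is, W = 1/2 sum_jk W_jk dz_j /\ dz_k; on real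
    tangent vectors it is evaluated through [dzv] and [push]. *)
Definition form2_eval (W : 'M[R[i]]_n) (v w : 'rV[R[i]]_n) : R[i] :=
  (v *m W *m w^T) 0 0.

Definition closed2 (W : tensor2) : Prop :=
  forall c p i j k, chart_at c p ->
    dz c i (fun q => W c q j k) p + dz c j (fun q => W c q k i) p
    + dz c k (fun q => W c q i j) p = 0.

(** [s, s] = 0 in coordinates. *)
Definition jacobi (s : tensor2) : Prop :=
  forall c p i j k, chart_at c p ->
    \sum_l (s c p i l * dz c l (fun q => s c q j k) p
          + s c p j l * dz c l (fun q => s c q k i) p
          + s c p k l * dz c l (fun q => s c q i j) p) = 0.

Definition holo_poisson (s : tensor2) : Prop :=
  [/\ bivector_tensorial s, holo_antisym s & jacobi s].

Definition holo_symplectic (W : tensor2) : Prop :=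
  [/\ form2_tensorial W, holo_antisym W, closed2 W &
      forall c p, chart_at c p -> W c p \in unitmx].

(** The Hamiltonian vector field s(df, -). *)
Definition hamiltonian (s : tensor2) (f : M -> R[i])
    (c : chart R n M) (p : M) : 'rV[R[i]]_n :=
  (\row_j dz c j f p) *m s c p.

(** The Poisson structure of a symplectic form [W]: the inverse of the map
    v |-> W(v, -). *)
Definition symplectic_poisson (W : tensor2) : tensor2 :=
  fun c p => invmx (W c p).

End Tensors.

Structure poissonManifold (R : realType) (n : nat) := PoissonManifold {
  pm_mfd :> complexManifold R n;
  pm_biv : tensor2 pm_mfd;
  pmP : holo_poisson pm_biv
}.

Structure symplecticManifold (R : realType) (n : nat) := SymplecticManifold {
  sm_mfd :> complexManifold R (n + n);
  sm_form : tensor2 sm_mfd;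
  smP : holo_symplectic sm_form
}.

(** * Morita equivalences and brane bisections *)

Section Morita.
Context {R : realType} {n : nat} (Z : symplecticManifold R n).
Let Om := @sm_form R n Z.

(** [e = 1] for a Poisson map from (Z, Om^-1) to (X, s), [e = -1] for an
    anti-Poisson one. *)
Definition poisson_map_sign (e : R[i]) (m : nat) (X : poissonManifold R m)
    (pi : Z -> X) : Prop :=
  forall c d z, chart_at c z -> chart_at d (pi z) ->
    (jac c d pi z)^T *m symplectic_poisson Om c z *m jac c d pi z
    = e *: pm_biv d (pi z).

Definition complete_map (m : nat) (X : poissonManifold R m) (pi : Z -> X) :
    Prop :=
  forall f : X -> R[i], holo_scalar [set: X] f ->
    complete_field (hamiltonian (@pm_biv R m X) f) ->
    complete_field (hamiltonian (symplectic_poisson Om) (f \o pi)).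

Record morita_equivalence (mm mp : nat)
    (Xm : poissonManifold R mm) (Xp : poissonManifold R mp)
    (pim : Z -> Xm) (pip : Z -> Xp) : Prop := {
  me_subm_m : holo_surj_submersion pim;
  me_subm_p : holo_surj_submersion pip;
  me_fibres_m : forall x, connected (pim @^-1` [set x]) /\
                          simply_connected R (pim @^-1` [set x]);
  me_fibres_p : forall x, connected (pip @^-1` [set x]) /\
                          simply_connected R (pip @^-1` [set x]);
  me_poisson : poisson_map_sign 1 pip;
  me_antipoisson : poisson_map_sign (-1) pim;
  (* each kernel is the symplectic orthogonal of the other *)
  me_orth : forall c dm dp z, chart_at c z ->
    chart_at dm (pim z) -> chart_at dp (pip z) ->
    forall v, v *m jac c dp pip z = 0 <->
      (forall w, w *m jac c dm pim z = 0 -> form2_eval (Om c z) v w = 0);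
  me_complete_m : complete_map pim;
  me_complete_p : complete_map pip
}.

(** [S] is the image of a smooth section of [pi]; it is then automatically an
    embedded smooth submanifold. *)
Definition section_of (m : nat) (X : poissonManifold R m) (pi : Z -> X)
    (S : set Z) : Prop :=
  exists s : X -> Z,
    [/\ smooth_map [set: X] s, cancel s pi & range s = S].

Definition lagrangian_Im (S : set Z) : Prop :=
  forall c z, chart_at c z -> S z -> forall v,
    tangent S c z v <->
    (forall w, tangent S c z w -> complex.Im (form2_eval (Om c z) v w) = 0).

Definition brane_bisection (mm mp : nat)
    (Xm : poissonManifold R mm) (Xp : poissonManifold R mp)
    (pim : Z -> Xm) (pip : Z -> Xp) (S : set Z) : Prop :=
  [/\ section_of pim S, section_of pip S & lagrangian_Im S].

End Morita.

(** * The holomorphic cotangent bundle *)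

Section Cotangent.
Context {R : realType} {n : nat}.

(** A (1,0)-covector at [cot_base]: in each chart [c] around the base point it
    is sum_j a_j dz_j with a = [cot_comp c].  The value 0 at the other charts
    makes equality of records the equality of covectors. *)
Record cotangent (L : charted R n) := Cotangent {
  cot_base : L;
  cot_comp : chart R n L -> 'rV[R[i]]_n;
  cot_compat : forall c d, chart_at c cot_base -> chart_at d cot_base ->
    cot_comp c = cot_comp d *m (trans_jac c d cot_base)^T;
  cot_out : forall c, ~ chart_at c cot_base -> cot_comp c = 0
}.

Variable L : charted R n.

(** Canonical coordinates (z, zeta) on T^*L over the chart [c]. *)
Definition cot_chart (c : chart R n L) : chart R (n + n) (cotangent L) :=
  {| cdom := [set xi | cdom c (cot_base xi)];
     coord := fun xi =>
       let z := coord c (cot_base xi) in let a := cot_comp xi c in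
       (row_mx z.1 (map_mx (@complex.Re R) a),
        row_mx z.2 (map_mx (@complex.Im R) a)) |}.

HB.instance Definition _ := gen_eqMixin (cotangent L).
HB.instance Definition _ := gen_choiceMixin (cotangent L).

(** The topology of T^*L is generated by the preimages of open sets under the
    canonical coordinates. *)
HB.instance Definition _ :=
  @isSubBaseTopological.Build (cotangent L) (set (cotangent L))
    [set A | exists c, atlas c /\ exists O : set (Cn R (n + n)),
       open O /\ A = cdom (cot_chart c) `&` coord (cot_chart c) @^-1` O]
    id.

Definition Tstar : charted R (n + n) :=
  @Charted R (n + n) (cotangent L)
    [set e | exists2 c, @atlas R n L c & e = cot_chart c].

(** Om0 = sum_j dzeta_j /\ dz_j = d(sum_j zeta_j dz_j) in every canonical chart,
    so that eta^*Om0 = d eta. *)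
Definition Om0 : tensor2 Tstar := fun _ _ => block_mx 0 (- 1%:M) 1%:M 0.

(** The graph of a (1,0)-form given by its components in each chart. *)
Definition graph10 (a : chart R n L -> L -> 'rV[R[i]]_n) : set (cotangent L) :=
  [set xi | forall c, chart_at c (cot_base xi) -> cot_comp xi c = a c (cot_base xi)].

End Cotangent.

(** * Darboux charts and potentials *)

Section Darboux.
Context {R : realType} {n : nat} (Z : symplecticManifold R n).
Let Om := @sm_form R n Z.

(** [L] is a holomorphic Lagrangian submanifold of [Z] through [i]. *)
Definition holo_lagrangian (L : complexManifold R n) (i : L -> Z) : Prop :=
  holo_embedding i /\
  forall c d x, chart_at c x -> chart_at d (i x) ->
    jac c d i x *m Om d (i x) *m (jac c d i x)^T = 0.

(** [phi] is defined on the open set [U] of T^*L and is the inclusion [i] on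
    the part of the zero section lying in [U]. *)
Definition darboux_chart (L : complexManifold R n) (i : L -> Z)
    (U : set (Tstar L)) (phi : Tstar L -> Z) : Prop :=
  [/\ holo_lagrangian i, open_holo_iso U phi,
      (forall c d xi, U xi -> chart_at c xi -> chart_at d (phi xi) ->
        jac c d phi xi *m Om d (phi xi) *m (jac c d phi xi)^T
        = @Om0 R n L c xi) &
      (forall xi : Tstar L, U xi -> (forall c, cot_comp xi c = 0) ->
        phi xi = i (cot_base xi))].

(** The part of [S] seen by the chart. *)
Definition in_chart (L : complexManifold R n) (U : set (Tstar L))
    (phi : Tstar L -> Z) (S : set Z) : set (Tstar L) :=
  U `&` phi @^-1` S.

(** In the chart, [S] is the graph of the smooth (1,0)-form [eta]. *)
Definition generic_chart (L : complexManifold R n) (U : set (Tstar L))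
    (phi : Tstar L -> Z) (S : set Z) (eta : L -> Tstar L) : Prop :=
  [/\ smooth_map [set: L] eta, (forall x, cot_base (eta x) = x) &
      in_chart U phi S = range eta].

(** (f^*Om)(v, w) for real tangent vectors v, w. *)
Definition pullback_Om (m : nat) (L : charted R m) (f : L -> Z)
    (c : chart R m L) (d : chart R (n + n) Z) (x : L) (v w : Cn R m) : R[i] :=
  form2_eval (Om d (f x)) (push c d f x v) (push c d f x w).

End Darboux.

Section Potential.
Context {R : realType} {n : nat} {L : charted R n}.

Definition smooth_real (K : L -> R) : Prop :=
  smooth_scalar [set: L] (fun x => (K x)%:C%C).

(** The components of - i del K. *)
Definition minus_i_del (K : L -> R) (c : chart R n L) (x : L) : 'rV[R[i]]_n :=
  \row_j (- 'i%C * dz c j (fun y => (K y)%:C%C) x).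

(** The value on real tangent vectors v, w of
    i del delbar K = i sum_jk (d^2K / dz_j dzbar_k) dz_j /\ dzbar_k. *)
Definition i_del_delbar (K : L -> R) (c : chart R n L) (x : L)
    (v w : Cn R n) : R[i] :=
  'i%C * \sum_j \sum_k
    dz c j (fun y => dzb c k (fun q => (K q)%:C%C) y) x
    * (dzv v 0 j * ((dzv w 0 k)^*)%C - dzv w 0 j * ((dzv v 0 k)^*)%C).

End Potential.

(* Main.v *)
(** The sought potential satisfies [dK = -2 Im eta].  Since the chart is
    symplectic, [d eta] is the pullback of [Omega] to the brane, so [Im eta] is
    closed because the brane is Lagrangian for [Im Omega], and it is exact
    because [L] is simply connected.  A (1,0)-form is determined by its imaginary
    part, hence [eta = - i del K]; and [d(- i del K) = i del delbar K].

    Only contractions of continuous loops are available, so exactness is not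
    obtained by integrating along paths: local primitives are continued along
    continuous maps, first along intervals and then along the square of a
    homotopy, which shows that continuation along a loop has no monodromy. *)
From HB Require Import structures.
Require Import Defs.
From mathcomp Require Import all_boot all_order all_algebra.
From mathcomp Require Import all_classical all_reals all_analysis.
From mathcomp Require Import lra ring.
Import Order.TTheory GRing.Theory Num.Theory.
Import numFieldNormedType.Exports.

Set Implicit Arguments.
Unset Strict Implicit.
Unset Printing Implicit Defensive.

Local Open Scope classical_set_scope.
Local Open Scope ring_scope.

(* [all_algebra] shadows the coordinate map of a chart by [vector.coord]. *)
Local Notation coord := Defs.coord.

(** * Continuation of local primitives *)

Lemma cousin (R : realType) (P : R -> R -> Prop) (l r : R) : l <= r ->
  (forall a b c, P a b -> P b c -> P a c) ->
  (forall t, l <= t <= r -> exists2 e, 0 < e & forall a b,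
     l <= a -> b <= r -> a <= t <= b -> t - e < a -> b < t + e -> P a b) ->
  P l r.
Proof.
move=> lr Padd Ploc.
pose S := [set t | l <= t <= r /\ P l t].
have Sl : S l.
  have [|e e0 He] := Ploc l; first by rewrite lexx.
  by rewrite /S /= lexx lr; split=> //; apply: He; rewrite ?lexx //; lra.
have Sub : ubound S r by move=> t [/andP[]].
have hS : has_sup S by split; [exists l | exists r].
have sr : sup S <= r by apply: ge_sup => //; exists l.
have ls : l <= sup S by apply: ub_le_sup => //; exists r.
have [|e e0 He] := Ploc (sup S); first by rewrite ls sr.
have [t [/andP[lt tr] Plt] st] := sup_adherent e0 hS.
have ts : t <= sup S by apply: ub_le_sup; [exists r | rewrite /S /= lt tr].
have Pb b : sup S <= b -> b <= r -> b < sup S + e -> P l b.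
  move=> sb br be; apply: (Padd _ t) => //; apply: He => //; apply/andP; split=> //.
have [rs|nsr] := eqVneq r (sup S); first by apply: Pb; rewrite -?rs //; lra.
have {}sr : sup S < r by rewrite lt_neqAle eq_sym nsr.
pose b := Num.min r (sup S + e / 2).
have sb : sup S < b by rewrite /b lt_min sr /=; lra.
have br : b <= r by rewrite /b ge_min lexx.
have be : b < sup S + e.
  by apply: le_lt_trans (_ : sup S + e / 2 < _);
    [rewrite /b ge_min lexx orbT | lra].
have : b <= sup S.
  apply: ub_le_sup; first by exists r.
  by rewrite /S /= br (le_trans ls (ltW sb)); split=> //; apply: Pb => //; exact: ltW.
by rewrite leNgt sb.
Qed.

Lemma locally_constant_eq (R : realType) (w : R -> R) (l r : R) : l <= r ->
  (forall q, l <= q <= r -> \forall q' \near q, l <= q' <= r -> w q' = w q) ->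
  w l = w r.
Proof.
move=> lr lw; apply: (cousin (P := fun a b => w a = w b)) => //.
  by move=> a b c ->.
move=> t tlr; have /nbhs_ballP[e /= e0 He] := lw t tlr.
exists e => // a b la br /andP[at_ tb] ea eb.
have -> : w a = w t.
  by apply: He; [rewrite /ball /= ltr_distlC; apply/andP; split; lra | lra].
symmetry.
by apply: He; [rewrite /ball /= ltr_distlC; apply/andP; split; lra | lra].
Qed.

Lemma continuous_pairl (S T : topologicalType) (t : T) :
  continuous (fun s : S => (s, t)).
Proof.
by move=> s; apply: (@cvg_pair _ _ _ _ (nbhs s) (nbhs t)); [exact: cvg_id | exact: cvg_cst].
Qed.

Lemma continuous_pairr (S T : topologicalType) (s : S) :
  continuous (fun t : T => (s, t)).
Proof.
by move=> t; apply: (@cvg_pair _ _ _ _ (nbhs s) (nbhs t)); [exact: cvg_cst | exact: cvg_id].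
Qed.

Section LocalPrimitives.
(** [F x] stands for a local primitive near [x]: only the differences
    [F x y - F x z] for [y] and [z] near [x] are meaningful. *)
Context {R : realType} {T : topologicalType} (F : T -> T -> R).

Definition prim (Q : topologicalType) (A : set Q) (h : Q -> T) (u : Q -> R) :=
  forall q, A q -> \forall q' \near q, A q' ->
    u q' - u q = F (h q) (h q') - F (h q) (h q).

Lemma prim_sub (Q : topologicalType) (A B : set Q) h u :
  B `<=` A -> prim A h u -> prim B h u.
Proof.
by move=> BA pA q /BA /pA; apply: filterS => q' Hq' /BA.
Qed.

Lemma prim_ext (Q : topologicalType) (A : set Q) h h' u u' :
  (forall q, A q -> h' q = h q) -> (forall q, A q -> u' q = u q) ->
  prim A h u -> prim A h' u'.
Proof.
move=> hh uu pA q Aq; move: (pA q Aq); apply: filterS => q' Hq' Aq'.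
by rewrite !hh // !uu // Hq'.
Qed.

Lemma prim_shift (Q : topologicalType) (A : set Q) h u k :
  prim A h u -> prim A h (fun q => u q + k).
Proof.
move=> pA q Aq; move: (pA q Aq); apply: filterS => q' /[apply] <-; ring.
Qed.

Lemma prim_reparam (Q Q' : topologicalType) (A : set Q) h u (g : Q' -> Q) :
  continuous g -> prim A h u -> prim (g @^-1` A) (h \o g) (u \o g).
Proof. by move=> cg pA q Aq; exact: (cg q _ (pA _ Aq)). Qed.

Lemma prim_sub_near (Q : topologicalType) (A : set Q) h u v :
  prim A h u -> prim A h v -> forall q, A q ->
  \forall q' \near q, A q' -> u q' - v q' = u q - v q.
Proof.
move=> pu pv q Aq; move: (pu q Aq) (pv q Aq); apply: filterS2 => q' h1 h2 Aq'.
by have := h1 Aq'; rewrite -(h2 Aq'); lra.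
Qed.

Lemma prim_glue (Q : topologicalType) (A B : set Q) h u v k :
  closed A -> closed B -> prim A h u -> prim B h v ->
  (forall q, A q -> B q -> u q = v q + k) ->
  exists w, prim (A `|` B) h w.
Proof.
move=> cA cB pu pv uv.
pose w q := if `[< A q >] then u q else v q + k.
have wA q : A q -> w q = u q by move=> Aq; rewrite /w asboolT.
have wB q : B q -> w q = v q + k.
  by move=> Bq; rewrite /w; case: asboolP => // Aq; exact: uv.
have far (C : set Q) q : closed C -> ~ C q -> \forall q' \near q, ~ C q'.
  by move=> cC nC; apply: open_nbhs_nbhs; split => //; exact: closed_openC.
have pA : prim A h w by apply: prim_ext pu.
have pB : prim B h w by apply: prim_ext (prim_shift k pv).
exists w => q.
have [Aq|nA] := pselect (A q); have [Bq|nB] := pselect (B q).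
- by move=> _; move: (pA q Aq) (pB q Bq); apply: filterS2 => q' h1 h2 [].
- by move=> _; move: (pA q Aq) (far _ q cB nB); apply: filterS2 => q' h1 h2 [].
- by move=> _; move: (far _ q cA nA) (pB q Bq); apply: filterS2 => q' h1 h2 [].
- by case.
Qed.

Hypothesis F_compat : forall x, \forall y \near x, \forall z \near y,
  F x z - F x y = F y z - F y y.

Lemma prim_local (Q : topologicalType) (A : set Q) (h : Q -> T) q :
  (forall q, A q -> forall W, nbhs (h q) W -> \forall q' \near q, A q' -> W (h q')) ->
  A q -> exists2 N, nbhs q N & prim (A `&` N) h (fun q' => F (h q) (h q')).
Proof.
move=> ch Aq.
exists [set q' | A q' -> \forall z \near h q',
    F (h q) z - F (h q) (h q') = F (h q') z - F (h q') (h q')].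
  exact: (ch q Aq _ (F_compat (h q))).
move=> q' [Aq' /(_ Aq') Nq'].
by move: (ch q' Aq' _ Nq'); apply: filterS => q'' Hq'' [/Hq''].
Qed.

Let box (a b c d : R) : set (R * R) :=
  [set q | (a <= q.1 <= b) && (c <= q.2 <= d)].

Let box_closed a b c d : closed (box a b c d).
Proof.
rewrite (_ : box a b c d = fst @^-1` `[a, b] `&` snd @^-1` `[c, d]).
  apply: closedI; apply: closed_comp; try exact: interval_closed.
    by move=> x _; exact: cvg_fst.
  by move=> x _; exact: cvg_snd.
by apply/seteqP; split=> x /=; rewrite /box /= !in_itv /=; [move/andP | move=> [-> ->]].
Qed.

Let prim_box_diff_h (h : R * R -> T) (A : set (R * R)) u v t a b : a <= b ->
  prim A h u -> prim A h v -> (forall s, a <= s <= b -> A (s, t)) ->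
  u (a, t) - v (a, t) = u (b, t) - v (b, t).
Proof.
move=> ab pu pv sub.
apply: (locally_constant_eq (w := fun s => u (s, t) - v (s, t)) ab) => q /sub Aq.
have cs := @continuous_pairl R R t.
have H : \forall q' \near q, A (q', t) -> u (q', t) - v (q', t) = u (q, t) - v (q, t).
  exact: (cs q _ (prim_sub_near pu pv Aq)).
by apply: filterS H => q' Hq' /sub /Hq'.
Qed.

Let prim_box_diff_v (h : R * R -> T) (A : set (R * R)) u v s a b : a <= b ->
  prim A h u -> prim A h v -> (forall t, a <= t <= b -> A (s, t)) ->
  u (s, a) - v (s, a) = u (s, b) - v (s, b).
Proof.
move=> ab pu pv sub.
apply: (locally_constant_eq (w := fun t => u (s, t) - v (s, t)) ab) => q /sub Aq.
have cs := @continuous_pairr R R s.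
have H : \forall q' \near q, A (s, q') -> u (s, q') - v (s, q') = u (s, q) - v (s, q).
  exact: (cs q _ (prim_sub_near pu pv Aq)).
by apply: filterS H => q' Hq' /sub /Hq'.
Qed.

Lemma prim_square (h : R * R -> T) :
  {within `[0, 1] `*` `[0, 1], continuous h} ->
  exists u, prim (Q := (R * R)%type) (`[0, 1] `*` `[0, 1]) h u.
Proof.
have SQE : `[0, 1] `*` `[0, 1] = box 0 1 0 1 :> set (R * R).
  by apply/seteqP; split=> x /=; rewrite /box /= !in_itv /=; [move=> [-> ->] | move/andP].
rewrite SQE => /subspace_continuousP ch.
have {}ch q : box 0 1 0 1 q -> forall W, nbhs (h q) W ->
    \forall q' \near q, box 0 1 0 1 q' -> W (h q').
  by move=> Bq W hW; exact: (ch q Bq W hW).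
have strip t : 0 <= t <= 1 -> exists2 e, 0 < e & exists u,
    prim (box 0 1 0 1 `&` box 0 1 (t - e) (t + e)) h u.
  move=> t01.
  apply: (cousin (P := fun a b => exists2 e, 0 < e & exists u,
    prim (box 0 1 0 1 `&` box a b (t - e) (t + e)) h u)); first exact: ler01.
    move=> a b c [e1 e10 [u1 p1]] [e2 e20 [u2 p2]].
    pose e := Num.min e1 e2.
    have e0 : 0 < e by rewrite lt_min e10.
    have ee1 : e <= e1 by rewrite ge_min lexx.
    have ee2 : e <= e2 by rewrite ge_min lexx orbT.
    have {}p1 : prim (box 0 1 0 1 `&` box a b (t - e) (t + e)) h u1.
      apply: prim_sub p1 => x [? /=] /andP[H1 /andP[H2 H3]]; split=> //.
      by rewrite /box /= H1 /=; lra.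
    have {}p2 : prim (box 0 1 0 1 `&` box b c (t - e) (t + e)) h u2.
      apply: prim_sub p2 => x [? /=] /andP[H1 /andP[H2 H3]]; split=> //.
      by rewrite /box /= H1 /=; lra.
    exists e => //.
    have [|||w pw] := @prim_glue _ _ _ _ _ _ (u1 (b, t) - u2 (b, t)) _ _ p1 p2.
    - by apply: closedI; exact: box_closed.
    - by apply: closedI; exact: box_closed.
    - move=> [s r] [/andP[/= s01 r01] /andP[/= sab rt]] [_ /andP[/= sbc _]].
      have sb : s = b by lra.
      move: p1 p2; set A1 := _ `&` _; set A2 := _ `&` _ => p1 p2.
      have q1 : prim (A1 `&` A2) h u1 by apply: prim_sub p1 => x [].
      have q2 : prim (A1 `&` A2) h u2 by apply: prim_sub p2 => x [].
      have HA y : (r <= y <= t) || (t <= y <= r) -> (A1 `&` A2) (b, y).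
        move=> Hy; rewrite /A1 /A2 /box /=; move: s01; rewrite sb.
        do ![split]; apply/andP; split; lra.
      rewrite sb; case: (leP r t) => rt'.
        have := prim_box_diff_v rt' q1 q2; move=> /(_ b) H.
        have {}H : u1 (b, r) - u2 (b, r) = u1 (b, t) - u2 (b, t).
          by apply: H => y Hy; apply: HA; rewrite Hy.
        lra.
      have := prim_box_diff_v (ltW rt') q1 q2; move=> /(_ b) H.
      have {}H : u1 (b, t) - u2 (b, t) = u1 (b, r) - u2 (b, r).
        by apply: H => y Hy; apply: HA; rewrite Hy orbT.
      lra.
    - exists w; apply: prim_sub pw => -[s r] [H1 /andP[/= H2 H3]].
      by case: (leP s b) => sb; [left | right]; split=> //; rewrite /box /= H3 andbT; lra.
  move=> s s01.
  have Bst : box 0 1 0 1 (s, t) by rewrite /box /= s01.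
  have [N nN pN] := prim_local ch Bst.
  have /nbhs_ballP[e /= e0 He] := nN.
  exists e => // a b a0 b1 sab ea eb; exists (e / 2); first by lra.
  exists (fun q' => F (h (s, t)) (h q')).
  apply: prim_sub pN => -[x y] [H1 /andP[/= H2 H3]]; split=> //.
  by apply: He; split; rewrite /ball /= ltr_distlC; apply/andP; split; lra.
suff [u pu] : exists u, prim (box 0 1 0 1 `&` box 0 1 0 1) h u.
  by exists u; rewrite setIid in pu.
apply: (cousin (P := fun a b => exists u,
    prim (box 0 1 0 1 `&` box 0 1 a b) h u)); first exact: ler01.
  move=> a b c [u1 p1] [u2 p2].
  have [|||w pw] := @prim_glue _ _ _ _ _ _ (u1 (0, b) - u2 (0, b)) _ _ p1 p2.
  - by apply: closedI; exact: box_closed.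
  - by apply: closedI; exact: box_closed.
  - move=> [s r] [/andP[/= s01 r01] /andP[/= sab rt]] [_ /andP[/= sbc rbc]].
    have rb : r = b by lra.
    move: p1 p2; set A1 := _ `&` _; set A2 := _ `&` _ => p1 p2.
    have q1 : prim (A1 `&` A2) h u1 by apply: prim_sub p1 => x [].
    have q2 : prim (A1 `&` A2) h u2 by apply: prim_sub p2 => x [].
    have s0 : 0 <= s by lra.
    have := prim_box_diff_h s0 q1 q2; move=> /(_ b) H.
    have {}H : u1 (0, b) - u2 (0, b) = u1 (s, b) - u2 (s, b).
      apply: H => y Hy; rewrite /A1 /A2 /box /=; move: r01; rewrite rb.
      by do ![split]; apply/andP; split; lra.
    by rewrite rb; lra.
  - exists w; apply: prim_sub pw => -[s r] [H1 /andP[/= H2 H3]].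
    by case: (leP r b) => sb; [left | right]; split=> //; rewrite /box /= H2 /=; lra.
move=> t /strip[e e0 [u pu]]; exists e => // a b a0 b1 tab ea eb; exists u.
apply: prim_sub pu => -[x y] [H1 /andP[/= H2 H3]]; split=> //.
by rewrite /box /= H2 /=; lra.
Qed.

Lemma prim_cst_eq (A : set R) (h : R -> T) u x : `[0, 1] `<=` A ->
  prim A h u -> (forall t, 0 <= t <= 1 -> h t = x) -> u 0 = u 1.
Proof.
move=> A01 pu hx; apply: locally_constant_eq; first exact: ler01.
move=> q q01; have Aq : A q by apply: A01; rewrite /= in_itv.
have := pu q Aq; apply: filterS => q' Hq' q'01.
have Aq' : A q' by apply: A01; rewrite /= in_itv.
by have := Hq' Aq'; rewrite !hx // subrr; lra.
Qed.

Lemma prim_loop (g : R -> T) (u : R -> R) :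
  simply_connected R [set: T] -> {within `[0, 1], continuous g} ->
  prim (Q := R) `[0, 1] g u -> g 0 = g 1 -> u 0 = u 1.
Proof.
move=> sc cg pu g01.
have [//|//|H [cH _ Hv Hh]] := sc g cg.
have [U pU] := prim_square cH.
have hor t : 0 <= t <= 1 -> prim (Q := R) `[0, 1] (fun s => H (s, t)) (fun s => U (s, t)).
  move=> t01.
  have cs := @continuous_pairl R R t.
  by apply: prim_sub (prim_reparam cs pU) => s /= s01; rewrite !in_itv /= t01.
have ver s : 0 <= s <= 1 -> prim (Q := R) `[0, 1] (fun t => H (s, t)) (fun t => U (s, t)).
  move=> s01.
  have cs := @continuous_pairr R R s.
  by apply: prim_sub (prim_reparam cs pU) => t /= t01; rewrite !in_itv /= s01.
have z01 : 0 <= (0 : R) <= 1 by rewrite lexx ler01.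
have o01 : 0 <= (1 : R) <= 1 by rewrite lexx ler01.
have E1 : U (0, 0) = U (1, 0).
  apply: (prim_cst_eq _ (hor 0 z01) (x := g 0)) => // s s01.
  by have [] := Hh s; rewrite ?in_itv.
have E2 : U (0, 1) = U (1, 1).
  apply: (prim_cst_eq _ (hor 1 o01) (x := g 0)) => // s s01.
  by have [] := Hh s; rewrite ?in_itv.
have E3 : U (1, 0) = U (1, 1).
  apply: (prim_cst_eq _ (ver 1 o01) (x := g 0)) => // s s01.
  by have [] := Hv s; rewrite ?in_itv.
have pg : prim (Q := R) `[0, 1] g (fun t => U (0, t)).
  by apply: prim_ext (ver 0 z01) => // t t01; have [->] := Hv t t01.
have : u 0 - U (0, 0) = u 1 - U (0, 1).
  apply: (locally_constant_eq (w := fun t => u t - U (0, t))); first exact: ler01.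
  move=> q q01; have Aq : `[0, 1]%classic q by rewrite /= in_itv.
  have := prim_sub_near pu pg Aq; apply: filterS => q' Hq' q'01.
  by apply: Hq'; rewrite /= in_itv.
by rewrite E1 E3 -E2; lra.
Qed.

End LocalPrimitives.

Definition locally_path_connected (R : realType) (T : topologicalType) :=
  forall (x : T) W, nbhs x W -> \forall y \near x,
    exists g : R -> T, [/\ continuous g, g 0 = x, g 1 = y & forall t, W (g t)].

Section GlobalPrimitive.
Context {R : realType} {T : topologicalType} (F : T -> T -> R).

Definition reach (x y : T) (r : R) := exists (g : R -> T) (u : R -> R),
  [/\ continuous g, prim F (Q := R) `[0, 1] g u, g 0 = x, g 1 = y &
      r = u 1 - u 0].

Lemma reach_rev x y r : reach x y r -> reach y x (- r).
Proof.
move=> [g [u [cg pu g0 g1 ->]]].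
have co : continuous (fun t : R => 1 - t).
  by move=> t; apply: cvgB; [exact: cvg_cst | exact: cvg_id].
exists (fun t => g (1 - t)), (fun t => u (1 - t)); split.
- by move=> t; apply: continuous_comp; [exact: co | exact: cg].
- by apply: prim_sub (prim_reparam co pu) => t /=; rewrite !in_itv /=; lra.
- by rewrite subr0.
- by rewrite subrr.
- by rewrite subr0 subrr opprB.
Qed.

Lemma reach_cat x y z r s : reach x y r -> reach y z s -> reach x z (r + s).
Proof.
move=> [g [u [cg pu g0 g1 ->]]] [h [v [ch pv h0 h1 ->]]].
have cl : continuous (fun t : R => 2 * t).
  by move=> t; apply: cvgM; [exact: cvg_cst | exact: cvg_id].
have cr : continuous (fun t : R => 2 * t - 1).
  by move=> t; apply: cvgB; [exact: cl | exact: cvg_cst].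
pose k t := if t <= 2^-1 then g (2 * t) else h (2 * t - 1).
pose w t := if t <= 2^-1 then u (2 * t) else v (2 * t - 1) + (u 1 - v 0).
have half2 : 2 * 2^-1 = 1 :> R by rewrite divff.
have kr t : 2^-1 <= t -> k t = h (2 * t - 1).
  rewrite /k; case: (leP t 2^-1) => // t1 t2; have -> : t = 2^-1 by lra.
  by rewrite half2 subrr g1 h0.
have wr t : 2^-1 <= t -> w t = v (2 * t - 1) + (u 1 - v 0).
  rewrite /w; case: (leP t 2^-1) => // t1 t2; have -> : t = 2^-1 by lra.
  by rewrite half2 subrr; ring.
have kl t : t <= 2^-1 -> k t = g (2 * t) by rewrite /k => ->.
have wl t : t <= 2^-1 -> w t = u (2 * t) by rewrite /w => ->.
have cgl : continuous (fun t : R => g (2 * t)).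
  by move=> t; apply: continuous_comp; [exact: cl | exact: cg].
have chr : continuous (fun t : R => h (2 * t - 1)).
  by move=> t; apply: continuous_comp; [exact: cr | exact: ch].
exists k, w; split.
- have le_of_eq (a b : R) : a = b -> a <= b by move=> ->.
  move=> t W Wk; change (\forall t' \near t, W (k t')).
  have nl : t <= 2^-1 -> \forall t' \near t, W (g (2 * t')).
    by move=> /kl kt; apply: (cgl t W); rewrite -kt.
  have nr : 2^-1 <= t -> \forall t' \near t, W (h (2 * t' - 1)).
    by move=> /kr kt; apply: (chr t W); rewrite -kt.
  case: (ltgtP t 2^-1) => t2.
  + move: (nl (ltW t2)) (lt_nbhsl t2); apply: filterS2 => t' Wt' t'2.
    by rewrite kl // ltW.
  + move: (nr (ltW t2)) (lt_nbhsr t2); apply: filterS2 => t' Wt' t'2.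
    by rewrite kr // ltW.
  + move: (nl (le_of_eq _ _ t2)) (nr (le_of_eq _ _ (esym t2))); apply: filterS2 => t' Wl' Wr'.
    by case: (leP t' 2^-1) => t'2; [rewrite kl | rewrite kr // ltW].
- have pl : prim F (Q := R) `[0, 2^-1] k w.
    apply: prim_ext (prim_sub _ (prim_reparam cl pu)).
    + by move=> t /=; rewrite in_itv /= => /andP[_ /kl].
    + by move=> t /=; rewrite in_itv /= => /andP[_ /wl].
    + by move=> t /=; rewrite !in_itv /=; lra.
  have pr : prim F (Q := R) `[2^-1, 1] k w.
    apply: prim_ext (prim_sub _ (prim_reparam cr (prim_shift (u 1 - v 0) pv))).
    + by move=> t /=; rewrite in_itv /= => /andP[/kr].
    + by move=> t /=; rewrite in_itv /= => /andP[/wr].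
    + by move=> t /=; rewrite !in_itv /=; lra.
  have [|||W pW] := prim_glue (k := 0) _ _ pl pr.
  + exact: interval_closed.
  + exact: interval_closed.
  + by move=> q _ _; rewrite addr0.
  move=> q; rewrite /= in_itv /= => q01.
  have [qc|qc|qc] := ltgtP q 2^-1.
  + have Aq : `[0, 2^-1]%classic q by rewrite /= in_itv /=; lra.
    move: (pl q Aq) (lt_nbhsl qc); apply: filterS2 => t Ht t2 t01.
    by apply: Ht; move: t01; rewrite /= !in_itv /=; lra.
  + have Aq : `[2^-1, 1]%classic q by rewrite /= in_itv /=; lra.
    move: (pr q Aq) (lt_nbhsr qc); apply: filterS2 => t Ht t2 t01.
    by apply: Ht; move: t01; rewrite /= !in_itv /=; lra.
  + have Aq : `[0, 2^-1]%classic q by rewrite /= in_itv /=; lra.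
    have Bq : `[2^-1, 1]%classic q by rewrite /= in_itv /=; lra.
    move: (pl q Aq) (pr q Bq); apply: filterS2 => t Hl Hr t01.
    case: (leP t 2^-1) => t2.
      by apply: Hl; move: t01; rewrite /= !in_itv /=; lra.
    by apply: Hr; move: t01; rewrite /= !in_itv /=; lra.
- by rewrite kl ?mulr0 // invr_ge0.
- by rewrite kr; [rewrite mulr1 -[2]/(1 + 1) addrK | lra].
- rewrite (wl 0) ?invr_ge0 // (wr 1); last lra.
  by rewrite mulr0 mulr1 -[2]/(1 + 1) addrK; ring.
Qed.

Hypothesis F_compat : forall x, \forall y \near x, \forall z \near y,
  F x z - F x y = F y z - F y y.

Lemma reach_local x : locally_path_connected R T ->
  \forall y \near x, reach x y (F x y - F x x).
Proof.
move=> lpc; have := lpc x _ (F_compat x); apply: filterS => y [g [cg g0 g1 Hg]].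
exists g, (fun t => F x (g t)); split=> //; last by rewrite g0 g1.
move=> t _; have H : \forall q \near t, F x (g q) - F x (g t) = F (g t) (g q) - F (g t) (g t).
  exact: (cg t _ (Hg t)).
by apply: filterS H.
Qed.

Lemma reach_unique x y r s : simply_connected R [set: T] ->
  reach x y r -> reach x y s -> r = s.
Proof.
move=> sc xr /reach_rev yr.
have [g [u [cg pu g0 g1 E]]] := reach_cat xr yr.
have := prim_loop F_compat sc (continuous_subspaceT cg) pu.
by rewrite g0 g1 => /(_ erefl); lra.
Qed.

Lemma global_primitive : connected [set: T] -> simply_connected R [set: T] ->
  locally_path_connected R T ->
  exists K : T -> R, forall x, \forall y \near x, K y - K x = F x y - F x x.
Proof.
move=> conn sc lpc.
have [[x0 _]|T0] := pselect ([set: T] !=set0); last first.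
  by exists (fun=> 0) => x; exfalso; apply: T0; exists x.
have reach0 : [set y | exists r, reach x0 y r] = [set: T].
  apply: conn.
  - exists x0, (F x0 x0 - F x0 x0).
    exact: nbhs_singleton (reach_local x0 lpc).
  - exists [set y | exists r, reach x0 y r]; last by rewrite setTI.
    rewrite openE => y [r xy]; have := reach_local y lpc; apply: filterS => z yz.
    by exists (r + (F y z - F y y)); exact: reach_cat xy yz.
  - exists [set y | exists r, reach x0 y r]; last by rewrite setTI.
    rewrite -openC openE => y ny; have := reach_local y lpc.
    apply: filterS => z yz [r xz]; apply: ny; exists (r - (F y z - F y y)).
    exact: reach_cat xz (reach_rev yz).
have ex y : exists r, reach x0 y r.
  by rewrite -[exists r, _]/([set y | exists r, reach x0 y r] y) reach0.
have [K HK] := choice ex.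
exists K => x; have := reach_local x lpc; apply: filterS => y xy.
have := reach_unique sc (HK y) (reach_cat (HK x) xy); lra.
Qed.

End GlobalPrimitive.

(** * Calculus in finite dimension *)

Section Calculus.
Context {R : realType}.
Implicit Types V W : normedModType R.

Lemma diff_eps V W (f : V -> W) (df : {linear V -> W}) x : continuous df ->
  (forall e, 0 < e -> \forall h \near 0, `|f (h + x) - f x - df h| <= e * `|h|) ->
  differentiable f x /\ 'd f x = df :> (V -> W).
Proof.
move=> cdf H.
have E : f \o shift x = cst (f x) + df +o_ 0 id.
  apply/eqaddoP => e e0; move: (H e e0); apply: filterS => h /=.
  by rewrite fctE /= opprD addrA.
have D := diff_unique cdf E; split=> //.
by apply/diff_locallyP; rewrite D.
Qed.

Lemma near_eq_differentiable V W (f g : V -> W) x :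
  (\forall y \near x, f y = g y) -> differentiable f x -> differentiable g x.
Proof.
move=> fg df; have cdf := diff_continuous df.
apply: (proj1 (@diff_eps _ _ g ('d f x) x cdf _)).
move=> e e0.
have /eqaddoP/(_ e e0) H := diff_locally df.
have fg' : \forall h \near (0 : V), f (h + x) = g (h + x).
  by move: fg; rewrite (near_shift 0) /= subr0; apply: filterS => h /=.
move: H fg'; apply: filterS2 => h /= + <-.
by rewrite -(nbhs_singleton fg) /= !fctE /= opprD addrA.
Qed.

Lemma is_derive_line V (f : V -> R) (p u : V) (t : R) :
  derivable f (p + t *: u) u ->
  is_derive t 1 (fun s : R => f (p + s *: u)) ('D_u f (p + t *: u)).
Proof.
have E : (fun h : R => h^-1 *: (f (p + (h *: (1 : R^o) + t) *: u) - f (p + t *: u))) =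
    (fun h : R => h^-1 *: (f (h *: u + (p + t *: u)) - f (p + t *: u))).
  apply/funext => h; congr (_ *: (f _ - _)).
  by rewrite scalerDl [h *: 1]mulr1 addrCA.
move=> df; split.
  by rewrite /derivable /= E.
by rewrite /derive /= E.
Qed.

Lemma line_MVT V (f : V -> R) (p u : V) :
  (forall t : R, 0 <= t <= 1 -> differentiable f (p + t *: u)) ->
  exists2 t, 0 <= t <= 1 & f (p + u) - f p = 'D_u f (p + t *: u).
Proof.
move=> df.
have id t : 0 <= t <= 1 ->
    is_derive (t : R) 1 (fun s : R => f (p + s *: u)) ('D_u f (p + t *: u)).
  by move=> /df dft; apply: is_derive_line; exact: diff_derivable.
have [|||t t01] := @MVT _ (fun s => f (p + s *: u)) (fun s => 'D_u f (p + s *: u)) 0 1.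
- exact: ltr01.
- by move=> x; rewrite in_itv /= => x01; apply: id; lra.
- apply: derivable_within_continuous => x; rewrite in_itv /= => x01.
  by have [] := id x x01.
rewrite scale1r scale0r addr0 subr0 mulr1 => ->; exists t => //.
by move: t01; rewrite in_itv /=; lra.
Qed.

Lemma ball_line V (y0 y : V) r (t : R) : ball y0 r y -> 0 <= t <= 1 ->
  ball y0 r (y0 + t *: (y - y0)).
Proof.
rewrite -ball_normE /= => yr /andP[t0 t1].
rewrite opprD addNKr normrN normrZ ger0_norm //.
by apply: le_lt_trans yr; rewrite -distrC ler_piMl.
Qed.

Lemma derive0_ball_cst V (f : V -> R) y0 r :
  (forall y, ball y0 r y -> differentiable f y /\ forall v, 'D_v f y = 0) ->
  forall y, ball y0 r y -> f y = f y0.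
Proof.
move=> df y yr.
have [|t t01] := @line_MVT V f y0 (y - y0).
  by move=> t t01; have [] := df _ (ball_line yr t01).
have [_ ->] := df _ (ball_line yr t01).
by rewrite subrKC => /eqP; rewrite subr_eq0 => /eqP.
Qed.

Lemma antiderivative (g : R -> R) :
  (forall t, 0 <= t <= 1 -> {for t, continuous g}) ->
  exists G : R -> R, [/\ G 0 = 0, {within `[0, 1], continuous G} &
    forall t : R, 0 < t < 1 -> is_derive t 1 G (g t)].
Proof.
move=> cg.
have cgw : {within `[0, 1], continuous g}.
  apply: continuous_in_subspaceT => x; rewrite inE /= in_itv /= => x01.
  exact: cg.
have ig := continuous_compact_integrable (@segment_compact _ 0 1) cgw.
pose mu := @lebesgue_measure R.
pose G y := (\int[mu]_(t in `[0, y]) g t)%R.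
exists G; split.
- by rewrite /G set_itv1 Rintegral_set1.
- apply: parameterized_integral_continuous => //; exact: ler01.
- move=> t /andP[t0 t1].
  have [|d1 d2] := @continuous_FTC1_closed _ g 0 t 1 t1 ig t0.
    by apply: cg; lra.
  by split; [exact: d1 | rewrite -derive1E; exact: d2].
Qed.

End Calculus.

Section CkTheory.
Context {R : realType}.
Implicit Types V W : normedModType R.

Lemma Ck_continuous V k (A : set V) (f : V -> R) : Ck k A f ->
  forall x, A x -> {for x, continuous f}.
Proof.
case: k => [|k] //= [df _] x Ax.
exact: differentiable_continuous (df x Ax).
Qed.

Lemma CkW V k (A : set V) (f : V -> R) : Ck k.+1 A f -> Ck k A f.
Proof.
elim: k f => [|k IH] f.
  by move=> /Ck_continuous.
by move=> /= [df Df]; split=> // v; apply: IH; exact: Df.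
Qed.

Lemma Ck_sub V k (A B : set V) (f : V -> R) : B `<=` A -> Ck k A f -> Ck k B f.
Proof.
move=> BA; elim: k f => [|k IH] f /=.
  by move=> cf x /BA /cf.
by move=> [df Df]; split=> [x /BA /df //|v]; exact: IH.
Qed.

Lemma Ck_ext V k (A : set V) (f g : V -> R) : open A ->
  (forall x, A x -> f x = g x) -> Ck k A f -> Ck k A g.
Proof.
move=> oA; elim: k f g => [|k IH] f g fg /=.
- move=> cf x Ax U; rewrite -fg // => fxU.
  have fU : \forall y \near x, U (f y) := cf x Ax U fxU.
  have := open_nbhs_nbhs (conj oA Ax); apply: filterS2 fU => y /= + /fg.
  by move=> + <-.
- move=> [df Df].
  have nfg x : A x -> \forall y \near x, f y = g y.
    by move=> Ax; have := open_nbhs_nbhs (conj oA Ax); apply: filterS => y /fg.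
  split=> [x Ax|v].
    exact: near_eq_differentiable (nfg x Ax) (df x Ax).
  by apply: (IH _ _ _ (Df v)) => x /nfg; exact: near_eq_derive.
Qed.

Lemma Ck_cst V k (A : set V) (a : R) : Ck k A (fun=> a).
Proof.
elim: k a => [|k IH] a /=; first by move=> x _; exact: cvg_cst.
split=> [x _|v]; first exact: differentiable_cst.
have -> : (fun x => 'D_v (fun=> a) x) = (fun=> 0 : R); last exact: IH.
by apply/funext => x; exact: derive_cst.
Qed.

Lemma Ck_add V k (A : set V) (f g : V -> R) : open A ->
  Ck k A f -> Ck k A g -> Ck k A (fun x => f x + g x).
Proof.
move=> oA; elim: k f g => [|k IH] f g /=.
  by move=> cf cg x Ax; apply: cvgD; [exact: cf | exact: cg].
move=> [df Df] [dg Dg]; split=> [x Ax|v].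
  by apply: differentiableD; [exact: df | exact: dg].
apply: (Ck_ext oA _ (IH _ _ (Df v) (Dg v))) => x Ax.
by rewrite -deriveD //; apply: diff_derivable; [exact: df | exact: dg].
Qed.

Lemma Ck_mul V k (A : set V) (f g : V -> R) : open A ->
  Ck k A f -> Ck k A g -> Ck k A (fun x => f x * g x).
Proof.
move=> oA; elim: k f g => [|k IH] f g.
  by move=> cf cg x Ax; apply: cvgM; [exact: cf | exact: cg].
move=> Cf Cg; have /= [df Df] := Cf; have /= [dg Dg] := Cg.
split=> [x Ax|v].
  by apply: differentiableM; [exact: df | exact: dg].
apply: (Ck_ext oA _ (Ck_add oA (IH _ _ (CkW Cf) (Dg v)) (IH _ _ (CkW Cg) (Df v)))).
by move=> x Ax; rewrite -deriveM //; apply: diff_derivable; [exact: df | exact: dg].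
Qed.

Lemma Ck_sum V (I : finType) k (A : set V) (f : I -> V -> R) : open A ->
  (forall i, Ck k A (f i)) -> Ck k A (fun x => \sum_i f i x).
Proof.
move=> oA Cf; elim: (index_enum I) => [|i s IH].
  rewrite (_ : (fun x => _) = (fun=> 0)); first exact: Ck_cst.
  by apply/funext => x; rewrite big_nil.
rewrite (_ : (fun x => _) = (fun x => f i x + \sum_(j <- s) f j x)).
  exact: Ck_add.
by apply/funext => x; rewrite big_cons.
Qed.

End CkTheory.

Section FiniteDimension.
Context {R : realType} (W : normedModType R) (I : finType).
Variables (e : I -> W) (co : I -> {linear W -> R}).
Hypothesis co_le : forall i w, `|co i w| <= `|w|.
Hypothesis co_sum : forall w, w = \sum_i co i w *: e i.
Implicit Types V : normedModType R.

Lemma co_continuous i : continuous (co i).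
Proof.
move=> x; apply/cvgrPdist_lt => eps eps0.
have := @nbhsx_ballx _ _ x eps eps0; apply: filterS => y.
by rewrite -ball_normE /= -linearB; apply: le_lt_trans.
Qed.

Lemma differentiable_co i x : differentiable (co i) x.
Proof. by apply: linear_differentiable; exact: co_continuous. Qed.

Lemma differentiable_from_co V (g : V -> W) x :
  (forall i, differentiable (fun y => co i (g y)) x) -> differentiable g x.
Proof.
move=> dg; rewrite (_ : g = \sum_i (fun y => co i (g y) *: e i)).
  elim/big_ind: _ => [|? ? ? ?|i _]; first exact: differentiable_cst.
    exact: differentiableD.
  exact: differentiableZl.
by apply/funext => y; rewrite fct_sumE -co_sum.
Qed.

Lemma continuous_from_co (T : topologicalType) (g : T -> W) x :
  (forall i, {for x, continuous (fun y => co i (g y))}) -> {for x, continuous g}.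
Proof.
move=> cg; rewrite (_ : g = (fun y => \sum_i (co i (g y) *: e i))).
  by apply: cvg_big => [|i _]; [exact: add_continuous | apply: cvgZr_tmp; exact: cg].
by apply/funext => y; rewrite -co_sum.
Qed.

Lemma derive_coE (f : W -> R) x v : differentiable f x ->
  'D_v f x = \sum_i co i v * 'D_(e i) f x.
Proof.
move=> df; rewrite deriveE // {1}(co_sum v) linear_sum; apply: eq_bigr => i _.
by rewrite linearZ /= deriveE.
Qed.

Lemma derive_comp V V' (f : V' -> R) (g : V -> V') x v :
  differentiable g x -> differentiable f (g x) ->
  'D_v (fun y => f (g y)) x = 'D_('D_v g x) f (g x).
Proof.
move=> dg df; rewrite deriveE; last exact: differentiable_comp.
by rewrite diff_comp //= -!deriveE.
Qed.

Lemma derive_co V (g : V -> W) i x v : differentiable g x ->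
  'D_v (fun y => co i (g y)) x = co i ('D_v g x).
Proof.
move=> dg; rewrite (@derive_comp _ _ (co i) g) //; last exact: differentiable_co.
rewrite deriveE; last exact: differentiable_co.
by rewrite diff_lin //; exact: co_continuous.
Qed.

Lemma derive_comp_co V (f : W -> R) (g : V -> W) x v :
  (forall i, differentiable (fun y => co i (g y)) x) -> differentiable f (g x) ->
  'D_v (fun y => f (g y)) x =
    \sum_i 'D_v (fun y => co i (g y)) x * 'D_(e i) f (g x).
Proof.
move=> dg df; have dg' := differentiable_from_co dg.
rewrite derive_comp // derive_coE //.
by apply: eq_bigr => i _; rewrite derive_co.
Qed.

Lemma Ck_comp V k (A : set V) (B : set W) (f : W -> R) (g : V -> W) : open A ->
  (forall x, A x -> B (g x)) -> Ck k B f ->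
  (forall i, Ck k A (fun x => co i (g x))) -> Ck k A (fun x => f (g x)).
Proof.
move=> oA AB; elim: k f => [|k IH] f.
  move=> cf cg x Ax; have := @continuous_comp _ _ _ g f x.
  apply; last exact/cf/AB.
  by apply: continuous_from_co => i; exact: cg.
move=> /= [df Df] Cg; split=> [x Ax|v].
  apply: differentiable_comp; last exact/df/AB.
  by apply: differentiable_from_co => i; exact: (Cg i).1.
apply: (@Ck_ext _ _ _ _
  (fun x => \sum_i 'D_v (fun y => co i (g y)) x * 'D_(e i) f (g x))) => //.
  move=> x Ax; rewrite derive_comp_co //; last exact/df/AB.
  by move=> i; exact: (Cg i).1.
apply: Ck_sum => // i; apply: Ck_mul => //; first exact: (Cg i).2.
by apply: (IH (fun y => 'D_(e i) f y)); [exact: Df | move=> j; apply: CkW; exact: Cg].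
Qed.

End FiniteDimension.

Section Poincare.
Context {R : realType} (W : normedModType R) (I : finType).
Variables (e : I -> W) (co : I -> {linear W -> R}).
Hypothesis co_le : forall i w, `|co i w| <= `|w|.
Hypothesis co_sum : forall w, w = \sum_i co i w *: e i.

Lemma sum_norm_le (f : I -> R) a : (forall i, `|f i| <= a) ->
  `|\sum_i f i| <= a *+ #|I|.
Proof.
move=> fa; apply: le_trans (ler_norm_sum _ _ _) _.
by rewrite -sumr_const; apply: ler_sum.
Qed.

Lemma strict_differentiability (A : set W) (f : W -> R) p eps : open A ->
  (forall x, A x -> differentiable f x) ->
  (forall i x, A x -> {for x, continuous ('D_(e i) f)}) -> A p -> 0 < eps ->
  exists2 d, 0 < d & forall q k : W, `|q - p| < d -> `|k| < d ->
    `|f (q + k) - f q| <= eps /\ `|f (q + k) - f q - 'D_k f q| <= eps * `|k|.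
Proof.
move=> oA df cDf Ap eps0.
pose N : R := #|I|.+1%:R; have N0 : 0 < N by rewrite ltr0n.
pose eps' := eps / (2 * N); have eps'0 : 0 < eps' by rewrite divr_gt0 // mulr_gt0.
have cf : {for p, continuous f} by apply: differentiable_continuous; exact: df.
have [d1 d10 Hd1] : exists2 d, 0 < d & forall q, `|q - p| < d ->
    [/\ A q, `|f q - f p| < eps / 2 & forall i, `|'D_(e i) f q - 'D_(e i) f p| < eps'].
  have H1 : \forall q \near p, A q := open_nbhs_nbhs (conj oA Ap).
  have H2 : \forall q \near p, `|f q - f p| < eps / 2.
    have /cvgrPdist_lt/(_ (eps / 2)) := cf; rewrite divr_gt0 // => /(_ isT).
    by apply: filterS => q; rewrite distrC.
  have H3 : \forall q \near p, forall i, `|'D_(e i) f q - 'D_(e i) f p| < eps'.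
    apply: filter_forall => i.
    have /cvgrPdist_lt/(_ eps' eps'0) := cDf i p Ap.
    by apply: filterS => q; rewrite distrC.
  have /nbhs_ballP[d /= d0 Hd] : \forall q \near p, [/\ A q, `|f q - f p| < eps / 2 &
      forall i, `|'D_(e i) f q - 'D_(e i) f p| < eps'].
    by apply: filterS3 H1 H2 H3.
  by exists d => // q qp; apply: Hd; rewrite -ball_normE /= distrC.
exists (d1 / 2); first by rewrite divr_gt0.
move=> q k qd kd.
have seg (t : R) : 0 <= t <= 1 -> `|q + t *: k - p| < d1.
  move=> /andP[t0 t1]; rewrite addrAC; apply: le_lt_trans (ler_normD _ _) _.
  have : `|t *: k| <= `|k| by rewrite normrZ ger0_norm // ler_piMl.
  lra.
have [|Aq fq Dq] := Hd1 q; first by lra.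
have [|_ fqk _] := Hd1 _ (seg 1 _); first by rewrite ler01 lexx.
rewrite scale1r in fqk.
split.
  rewrite (_ : _ - _ = (f (q + k) - f p) - (f q - f p)); last by ring.
  by apply: le_trans (ler_normB _ _) _; lra.
have [t t01 ->] : exists2 t, 0 <= t <= 1 & f (q + k) - f q = 'D_k f (q + t *: k).
  by apply: line_MVT => t /seg /Hd1[At _ _]; exact: df.
have [At _ Dt] := Hd1 _ (seg t t01).
rewrite (derive_coE co_sum k (df _ At)) (derive_coE co_sum k (df _ Aq)) -sumrB.
have H i : `|co i k * 'D_(e i) f (q + t *: k) - co i k * 'D_(e i) f q| <= 2 * eps' * `|k|.
  rewrite -mulrBr normrM mulrC ler_pM //.
  rewrite (_ : _ - _ = ('D_(e i) f (q + t *: k) - 'D_(e i) f p) -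
    ('D_(e i) f q - 'D_(e i) f p)); last by ring.
  by apply: le_trans (ler_normB _ _) _; have := Dt i; have := Dq i; lra.
apply: le_trans (sum_norm_le H) _.
rewrite -[X in X <= _]mulr_natr
  (_ : 2 * eps' * `|k| * #|I|%:R = (2 * eps' * #|I|%:R) * `|k|); last by ring.
rewrite ler_wpM2r //.
have -> : eps = 2 * eps' * N by rewrite /eps'; field; rewrite gt_eqF.
by rewrite ler_wpM2l ?ler_nat //; lra.
Qed.

Lemma uniform_strict_differentiability (A : set W) (f : W -> R) (p u : W) eps :
  open A -> (forall x, A x -> differentiable f x) ->
  (forall i x, A x -> {for x, continuous ('D_(e i) f)}) ->
  (forall t : R, 0 <= t <= 1 -> A (p + t *: u)) -> 0 < eps ->
  exists2 d, 0 < d & forall (t : R) (k : W), 0 <= t <= 1 -> `|k| < d ->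
    `|f (p + t *: u + k) - f (p + t *: u)| <= eps /\
    `|f (p + t *: u + k) - f (p + t *: u) - 'D_k f (p + t *: u)| <= eps * `|k|.
Proof.
move=> oA df cDf Apu eps0.
apply: (cousin (P := fun a b => exists2 d, 0 < d &
  forall (t : R) (k : W), a <= t <= b -> `|k| < d ->
    `|f (p + t *: u + k) - f (p + t *: u)| <= eps /\
    `|f (p + t *: u + k) - f (p + t *: u) - 'D_k f (p + t *: u)| <= eps * `|k|)).
- exact: ler01.
- move=> a b c [d1 d10 H1] [d2 d20 H2]; exists (Num.min d1 d2).
    by rewrite lt_min d10.
  move=> t k /andP[at_ tc]; rewrite lt_min => /andP[k1 k2].
  by case: (leP t b) => tb; [apply: H1 => //; rewrite at_ | apply: H2 => //; rewrite tc ltW].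
- move=> t t01.
  have [d d0 H] := strict_differentiability oA df cDf (Apu t t01) eps0.
  exists (d / (`|u| + 1)); first by rewrite divr_gt0 // ltr_wpDl.
  move=> a b a0 b1 tab ta tb; exists d => // s k sab kd; apply: H => //.
  rewrite opprD addrACA subrr add0r -scalerBl normrZ.
  have st : `|s - t| < d / (`|u| + 1) by rewrite ltr_distl; apply/andP; split; lra.
  have u1 : 0 < `|u| + 1 by rewrite ltr_wpDl.
  have : `|s - t| * (`|u| + 1) < d by rewrite -ltr_pdivlMr.
  by apply: le_lt_trans; rewrite ler_wpM2l // lerDl.
Qed.

(** The primitive is [phi y = int_0^1 sum_i (y - y0)_i b_i (y0 + t (y - y0)) dt].
    Its differentiability is obtained by applying the mean value theorem in [t]
    to [G (y + h) t - G y t - t * sum_i h_i b_i (y0 + t (y - y0))], where [G y]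
    is an antiderivative of the integrand: closedness makes the [t]-derivative
    of this function [o(|h|)], uniformly in [t]. *)
Lemma poincare (y0 : W) r (b : I -> W -> R) :
  (forall i x, ball y0 r x -> differentiable (b i) x) ->
  (forall i j x, ball y0 r x -> {for x, continuous ('D_(e j) (b i))}) ->
  (forall i j x, ball y0 r x -> 'D_(e i) (b j) x = 'D_(e j) (b i) x) ->
  exists phi : W -> R, forall y, ball y0 r y ->
    differentiable phi y /\ forall v, 'D_v phi y = \sum_i co i v * b i y.
Proof.
move=> db cDb closed_b.
pose gam (y : W) (t : R) := y0 + t *: (y - y0).
pose g y t := \sum_i co i (y - y0) * b i (gam y t).
have gamB y t : ball y0 r y -> 0 <= t <= 1 -> ball y0 r (gam y t).
  exact: ball_line.
have is_der_b i y t : ball y0 r y -> 0 <= t <= 1 ->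
    is_derive (t : R) 1 (fun s => b i (gam y s)) ('D_(y - y0) (b i) (gam y t)).
  move=> yr t01; apply: is_derive_line; apply: diff_derivable.
  exact/db/gamB.
have G_ex y : exists G : R -> R, ball y0 r y ->
    [/\ G 0 = 0, {within `[0, 1], continuous G} &
      forall t : R, 0 < t < 1 -> is_derive t 1 G (g y t)].
  have [yr|] := pselect (ball y0 r y); last by exists (fun=> 0).
  have [|G HG] := @antiderivative R (g y); last by exists G.
  move=> t t01; apply: cvg_big => [|i _]; first exact: add_continuous.
  apply: cvgM; first exact: cvg_cst.
  apply: differentiable_continuous; apply/derivable1_diffP.
  by have [] := is_der_b i y t yr t01.
have [G HG] := choice G_ex.
exists (fun y => G y 1) => y yr.
have oB : open (ball y0 r) by exact: ball_open.
have lin : linear (fun h => \sum_i co i h * b i y).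
  move=> a h h'; rewrite scaler_sumr -big_split /=; apply: eq_bigr => i _.
  by rewrite linearP /= mulrDl -scalerAl.
pose dfM := GRing.isLinear.Build _ _ _ _ _ lin.
pose df : {linear W -> R} := HB.pack (fun h => \sum_i co i h * b i y) dfM.
have cdf : continuous df.
  move=> h; apply: cvg_big => [|i _]; first exact: add_continuous.
  by apply: cvgM; [exact: co_continuous | exact: cvg_cst].
suff [d1 d2] : differentiable (fun y => G y 1) y /\ 'd (fun y => G y 1) y = df :> (W -> R).
  by split=> // v; rewrite deriveE // d2.
apply: diff_eps => // eps eps0.
pose u := y - y0.
pose N : R := #|I|.+1%:R; have N0 : 0 < N by rewrite ltr0n.
have C0 : 0 < (`|u| + 1) * N by rewrite mulr_gt0 // ltr_wpDl.
pose eps' := eps / ((`|u| + 1) * N); have eps'0 : 0 < eps' by rewrite divr_gt0.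
have [d d0 Hd] : exists2 d, 0 < d & forall i (t : R) (k : W), 0 <= t <= 1 -> `|k| < d ->
    `|b i (gam y t + k) - b i (gam y t)| <= eps' /\
    `|b i (gam y t + k) - b i (gam y t) - 'D_k (b i) (gam y t)| <= eps' * `|k|.
  pose Q i dl := forall (t : R) (k : W), 0 <= t <= 1 -> `|k| < dl ->
    `|b i (gam y t + k) - b i (gam y t)| <= eps' /\
    `|b i (gam y t + k) - b i (gam y t) - 'D_k (b i) (gam y t)| <= eps' * `|k|.
  have [|dl Hdl] := @choice _ _ (fun i dl => 0 < dl /\ Q i dl).
    move=> i.
    have [|d d0 Hd] :=
      @uniform_strict_differentiability _ (b i) y0 u eps' oB (db i) (cDb i) _ eps'0.
      by move=> t t01; exact: gamB.
    by exists d.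
  exists (\big[Order.min/1]_i dl i).
    by elim/big_ind: _ => // [a c a0 c0|i _]; [rewrite lt_min a0 | have [] := Hdl i].
  move=> i t k t01 kd; have [_] := Hdl i; apply=> //.
  by apply: lt_le_trans kd _; exact: bigmin_le.
have /nbhs_ballP[r' /= r'0 Hr'] : nbhs y (ball y0 r) by apply: open_nbhs_nbhs.
apply/nbhs_ballP; exists (Num.min d r'); first by rewrite /= lt_min d0.
move=> h; rewrite -ball_normE /= sub0r normrN lt_min => /andP[hd hr].
have yhr : ball y0 r (h + y).
  by apply: Hr'; rewrite -ball_normE /= opprD addrCA subrr addr0 normrN.
have [G0 cG dG] := HG _ yr; have [G'0 cG' dG'] := HG _ yhr.
pose Psi (t : R) := G (h + y) t - G y t - t * \sum_i co i h * b i (gam y t).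
pose dPsi t := g (h + y) t - g y t -
  (\sum_i co i h * b i (gam y t) + t * \sum_i co i h * 'D_u (b i) (gam y t)).
have is_der_s t : 0 <= t <= 1 ->
    is_derive (t : R) 1 (fun t => \sum_i co i h * b i (gam y t))
      (\sum_i co i h * 'D_u (b i) (gam y t)).
  move=> t01; elim: (index_enum I) => [|i s IH].
    rewrite big_nil (_ : (fun t => _) = cst 0); first exact: is_derive_cst.
    by apply/funext => s; rewrite big_nil.
  rewrite big_cons (_ : (fun t => _) =
    (fun t => co i h * b i (gam y t)) + (fun t => \sum_(j <- s) co j h * b j (gam y t))).
    by apply: is_deriveD; apply: is_deriveZ; exact: is_der_b.
  by apply/funext => t'; rewrite big_cons.
have is_der_ts t : 0 <= t <= 1 ->
    is_derive (t : R) 1 (fun t => t * \sum_i co i h * b i (gam y t))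
      (t * (\sum_i co i h * 'D_u (b i) (gam y t)) + \sum_i co i h * b i (gam y t)).
  move=> t01; have Ht := is_der_s t t01.
  by apply: is_derive_eq; rewrite [_ *: 1]mulr1.
have [|||t t01] := @MVT _ Psi dPsi 0 1.
- exact: ltr01.
- move=> t; rewrite in_itv /= => t01.
  apply: is_derive_eq.
    apply: is_deriveB; last by apply: is_der_ts; lra.
    by apply: is_deriveB; [exact: dG' | exact: dG].
  by rewrite /dPsi; ring.
- move=> t; apply: cvgB.
    by apply: cvgB; [exact: cG' | exact: cG].
  move: t; apply: derivable_within_continuous => t; rewrite in_itv /= => t01.
  by have [] := is_der_ts t t01.
move: t01; rewrite in_itv /= => t01'; have t01 : 0 <= t <= 1 by lra.
have gam1 z : gam z 1 = z by rewrite /gam scale1r addrC subrK.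
rewrite subr0 mulr1 /Psi G0 G'0 gam1 mul0r mul1r !subr0 => ->.
pose k := t *: h; have kh : `|k| <= `|h|.
  by rewrite normrZ ger0_norm; [rewrite ler_piMl //; lra | lra].
have kd : `|k| < d by exact: le_lt_trans hd.
have gamk : gam (h + y) t = gam y t + k.
  by rewrite /gam /k -(addrA h) scalerDr addrCA addrC.
have -> : dPsi t = \sum_i (co i u * (b i (gam y t + k) - b i (gam y t) - 'D_k (b i) (gam y t))
    + co i h * (b i (gam y t + k) - b i (gam y t))).
  have sym : \sum_i co i u * 'D_k (b i) (gam y t) = t * \sum_i co i h * 'D_u (b i) (gam y t).
    have gB := gamB y t yr t01.
    under eq_bigr => i _ do rewrite (derive_coE co_sum _ (db i _ gB)) mulr_sumr.
    rewrite exchange_big /= mulr_sumr; apply: eq_bigr => i _.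
    rewrite (derive_coE co_sum _ (db i _ gB)) !mulr_sumr; apply: eq_bigr => j _.
    by rewrite /k linearZ /= (closed_b i j) //; change (t *: co i h) with (t * co i h); ring.
  rewrite /dPsi -sym /g gamk -!sumrB -big_split /= -sumrB; apply: eq_bigr => i _.
  by rewrite -(addrA h) linearD /= -/u; ring.
have Hi i : `|co i u * (b i (gam y t + k) - b i (gam y t) - 'D_k (b i) (gam y t))
    + co i h * (b i (gam y t + k) - b i (gam y t))| <= (`|u| + 1) * eps' * `|h|.
  have [H1 H2] := Hd i t k t01 kd.
  apply: le_trans (ler_normD _ _) _; rewrite !normrM -mulrA mulrDl mul1r.
  apply: lerD; last by rewrite mulrC ler_pM.
  apply: ler_pM => //; apply: le_trans H2 _.
  by rewrite ler_wpM2l // ltW.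
apply: le_trans (sum_norm_le Hi) _.
rewrite -[X in X <= _]mulr_natr mulrAC ler_wpM2r //.
have -> : eps = (`|u| + 1) * eps' * N.
  by rewrite /eps'; field; rewrite !gt_eqF // ltr_wpDl.
rewrite ler_wpM2l ?ler_nat //; apply: mulr_ge0; last exact: ltW.
by rewrite addr_ge0.
Qed.

End Poincare.

Section ComplexCalculus.
Context {R : realType} {n : nat}.
Local Notation I := ('I_n + 'I_n)%type.
Implicit Types (v w x : Cn R n) (f : Cn R n -> R[i]).

Definition cbas (i : I) : Cn R n :=
  match i with inl j => ex j | inr j => ey j end.

Definition ccoord (i : I) (v : Cn R n) : R :=
  match i with inl j => v.1 0 j | inr j => v.2 0 j end.

Lemma ccoord_is_linear i : linear (ccoord i).
Proof. by case: i => j a u v /=; rewrite !mxE. Qed.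

HB.instance Definition _ i :=
  GRing.isLinear.Build R (Cn R n) R _ (ccoord i) (ccoord_is_linear i).

Lemma ccoord_le i v : `|ccoord i v| <= `|v|.
Proof.
have H (A : 'rV[R]_n) j : `|A 0 j| <= `|A|.
  by rewrite /Num.norm /= mx_normrE;
    apply: (le_bigmax _ (fun i : 'I_1 * 'I_n => `|A i.1 i.2|) (0, j)).
by case: i => j /=; rewrite prod_normE le_max H ?orbT.
Qed.

Lemma sum_I (V : nmodType) (F : I -> V) :
  \sum_i F i = \sum_j F (inl j) + \sum_j F (inr j).
Proof. by rewrite big_sumType. Qed.

Lemma ccoord_sum v : v = \sum_i ccoord i v *: cbas i.
Proof.
rewrite sum_I /=; case: v => a b /=.
have E (z : 'rV[R]_n) : \sum_j z 0 j *: delta_mx 0 j = z by rewrite -row_sum_delta.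
have El : (\sum_j a 0 j *: ex j : Cn R n) = (a, 0).
  rewrite -{2}(E a); elim/big_rec2: _ => // j u w _ ->.
  by congr (_, _); rewrite /= ?scaler0 ?addr0.
have Er : (\sum_j b 0 j *: ey j : Cn R n) = (0, b).
  rewrite -{2}(E b); elim/big_rec2: _ => // j u w _ ->.
  by congr (_, _); rewrite /= ?scaler0 ?addr0.
by rewrite El Er; congr (_, _); rewrite /= ?addr0 ?add0r.
Qed.

Lemma ccoord_bas i j : ccoord i (cbas j) = (i == j)%:R.
Proof.
by case: i j => i [] j; rewrite /= !mxE ?eqxx.
Qed.

Lemma sum_ccoord_bas (F : I -> R) i : \sum_j ccoord j (cbas i) * F j = F i.
Proof.
rewrite (bigD1 i) //= ccoord_bas eqxx mul1r big1 ?addr0 // => j ji.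
by rewrite ccoord_bas (negbTE ji) mul0r.
Qed.

Definition cdifferentiable (V : normedModType R) (f : V -> R[i]) (x : V) :=
  differentiable (fun y => complex.Re (f y)) x /\
  differentiable (fun y => complex.Im (f y)) x.

Lemma csmooth_cdifferentiable (V : normedModType R) (A : set V) (f : V -> R[i]) (x : V) :
  csmooth A f -> A x -> cdifferentiable f x.
Proof. by move=> [/(_ 1)/= [H1 _] /(_ 1)/= [H2 _]] Ax; split; [exact: H1 | exact: H2]. Qed.

Lemma Re_add (a b : R[i]) : complex.Re (a + b) = complex.Re a + complex.Re b.
Proof. by case: a b => a1 a2 [b1 b2]. Qed.

Lemma Im_add (a b : R[i]) : complex.Im (a + b) = complex.Im a + complex.Im b.
Proof. by case: a b => a1 a2 [b1 b2]. Qed.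

Lemma Re_sum (J : finType) (F : J -> R[i]) :
  complex.Re (\sum_j F j) = \sum_j complex.Re (F j).
Proof. by elim/big_rec2: _ => // j a b _ <-; rewrite Re_add. Qed.

Lemma Im_sum (J : finType) (F : J -> R[i]) :
  complex.Im (\sum_j F j) = \sum_j complex.Im (F j).
Proof. by elim/big_rec2: _ => // j a b _ <-; rewrite Im_add. Qed.

Lemma Re_real_comb (a b : R) (z w : R[i]) :
  complex.Re (a%:C%C * z + b%:C%C * w) = a * complex.Re z + b * complex.Re w.
Proof. by case: z w => ? ? [? ?] /=; rewrite !mul0r !subr0. Qed.

Lemma Im_real_comb (a b : R) (z w : R[i]) :
  complex.Im (a%:C%C * z + b%:C%C * w) = a * complex.Im z + b * complex.Im w.
Proof. by case: z w => ? ? [? ?] /=; rewrite !mul0r !addr0. Qed.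

Lemma cD_bas f x v : cdifferentiable f x -> cD v f x =
  \sum_j ((v.1 0 j)%:C%C * cD (ex j) f x + (v.2 0 j)%:C%C * cD (ey j) f x).
Proof.
move=> [dr di]; rewrite {1}/cD (derive_coE ccoord_sum _ dr) (derive_coE ccoord_sum _ di).
rewrite !sum_I -!big_split /=.
apply/eqP; rewrite eq_complex Re_sum Im_sum; apply/andP; split; apply/eqP.
  apply: eq_bigr => j _.
  exact: esym (Re_real_comb _ _ (cD (ex j) f x) (cD (ey j) f x)).
apply: eq_bigr => j _.
exact: esym (Im_real_comb _ _ (cD (ex j) f x) (cD (ey j) f x)).
Qed.

Lemma cD_wirt f x v : cdifferentiable f x -> cD v f x =
  \sum_j (wirt j f x * dzv v 0 j + wirtb j f x * ((dzv v 0 j)^*)%C).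
Proof.
move=> df; rewrite cD_bas //; apply: eq_bigr => j _.
rewrite /wirt /wirtb !mxE.
move: (cD (ex j) f x) (cD (ey j) f x) => A B.
have -> : (v.1 0 j +i* v.2 0 j)%C = (v.1 0 j)%:C%C + 'i%C * (v.2 0 j)%:C%C.
  by apply/eqP; rewrite eq_complex /=; apply/andP; split; apply/eqP; ring.
have -> : (((v.1 0 j)%:C%C + 'i%C * (v.2 0 j)%:C%C)^*)%C =
    (v.1 0 j)%:C%C - 'i%C * (v.2 0 j)%:C%C.
  by apply/eqP; rewrite eq_complex /=; apply/andP; split; apply/eqP; ring.
have ii : 'i%C * 'i%C = -1 :> R[i].
  by apply/eqP; rewrite eq_complex /=; apply/andP; split; apply/eqP; ring.
move: ((v.1 0 j)%:C%C) ((v.2 0 j)%:C%C) => a b.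
apply: (@mulfI _ 2); first by rewrite pnatr_eq0.
have h2 : 2 * 2^-1 = 1 :> R[i] by rewrite divff ?pnatr_eq0.
move: (2^-1) h2 => c h2.
transitivity ((2 * c) * (2 * a * A - 2 * ('i%C * 'i%C) * b * B)).
  by rewrite h2 ii; ring.
by ring.
Qed.

Lemma cD_near (V : normedModType R) (f g : V -> R[i]) (x v : V) :
  (\forall y \near x, f y = g y) -> cD v f x = cD v g x.
Proof.
by move=> fg; congr (_ +i* _)%C; apply: near_eq_derive; apply: filterS fg => y ->.
Qed.

Lemma cdifferentiable_near (V : normedModType R) (f g : V -> R[i]) (x : V) :
  (\forall y \near x, f y = g y) -> cdifferentiable f x -> cdifferentiable g x.
Proof.
move=> fg [dr di]; split; [move: dr | move: di];
  by apply: near_eq_differentiable; apply: filterS fg => y ->.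
Qed.

Lemma differentiable_ccoord (V : normedModType R) (T : V -> Cn R n) (x : V) :
  (forall k, cdifferentiable (fun y => dzv (T y) 0 k) x) ->
  forall i, differentiable (fun y => ccoord i (T y)) x.
Proof.
move=> dT [j|j] /=.
  have [+ _] := dT j; rewrite (_ : (fun y => _) = (fun y => (T y).1 0 j)) //.
  by apply/funext => y; rewrite mxE.
have [_] := dT j; rewrite (_ : (fun y => _) = (fun y => (T y).2 0 j)) //.
by apply/funext => y; rewrite mxE.
Qed.

Lemma dzv_derive (V : normedModType R) (T : V -> Cn R n) (x v : V) k :
  (forall k, cdifferentiable (fun y => dzv (T y) 0 k) x) ->
  dzv ('D_v T x) 0 k = cD v (fun y => dzv (T y) 0 k) x.
Proof.
move=> /differentiable_ccoord/(differentiable_from_co ccoord_sum) dT.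
rewrite mxE /cD.
congr (_ +i* _)%C.
  apply: eq_trans (esym (derive_co ccoord_le (inl k) v dT)) _.
  by congr ('D_v _ x); apply/funext => y; rewrite mxE.
apply: eq_trans (esym (derive_co ccoord_le (inr k) v dT)) _.
by congr ('D_v _ x); apply/funext => y; rewrite mxE.
Qed.

Lemma cD_comp (V : normedModType R) (T : V -> Cn R n) f (x v : V) :
  (forall k, cdifferentiable (fun y => dzv (T y) 0 k) x) ->
  cdifferentiable f (T x) ->
  cD v (fun y => f (T y)) x = cD ('D_v T x) f (T x).
Proof.
move=> /differentiable_ccoord/(differentiable_from_co ccoord_sum) dT [dr di].
by rewrite /cD; congr (_ +i* _)%C; rewrite -derive_comp.
Qed.

Lemma csmooth_comp (V : normedModType R) (A : set V) (B : set (Cn R n))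
    (T : V -> Cn R n) f : open A -> (forall x : V, A x -> B (T x)) ->
  csmooth B f -> (forall k, csmooth A (fun y => dzv (T y) 0 k)) ->
  csmooth A (fun y => f (T y)).
Proof.
move=> oA AB [fr fi] sT.
have sc i k : Ck k A (fun y => ccoord i (T y)).
  case: i => j /=.
    have [+ _] := sT j => /(_ k).
    by rewrite (_ : (fun y => _) = (fun y => (T y).1 0 j)) //; apply/funext => y; rewrite mxE.
  have [_ +] := sT j => /(_ k).
  by rewrite (_ : (fun y => _) = (fun y => (T y).2 0 j)) //; apply/funext => y; rewrite mxE.
split=> k.
  exact: (Ck_comp ccoord_le ccoord_sum oA AB (fr k) (sc^~ k)).
exact: (Ck_comp ccoord_le ccoord_sum oA AB (fi k) (sc^~ k)).
Qed.

End ComplexCalculus.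

(** * Functions on complex manifolds in charts *)

Lemma csmooth_ext (R : realType) (V : normedModType R) (A : set V) (f g : V -> R[i]) :
  open A -> (forall x : V, A x -> f x = g x) -> csmooth A f -> csmooth A g.
Proof.
move=> oA fg [sr si]; split=> k.
  by apply: (Ck_ext oA _ (sr k)) => x /fg ->.
by apply: (Ck_ext oA _ (si k)) => x /fg ->.
Qed.

Lemma lrepE (R : realType) (n : nat) (M : charted R n) (c : chart R n M) (g : M -> R[i]) q :
  set_inj (cdom c) (coord c) -> cdom c q -> lrep c g (coord c q) = g q.
Proof.
move=> ic cq; rewrite /lrep; case: xgetP => [y _ [q' [cq' /= qq'] <-]|H].
  by rewrite (ic q' q) ?inE.
by exfalso; apply: (H (g q)); exists q.
Qed.

Section LocalRepresentatives.
Context {R : realType} {n : nat}.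
Context (M : complexManifold R n).
Implicit Types (c d : chart R n M) (q x : M).

Lemma chart_lrepE c (g : M -> R[i]) q : chart_at c q -> lrep c g (coord c q) = g q.
Proof. by move=> [ac cq]; apply: lrepE => //; exact: (cm_inj (cmP M)). Qed.

Lemma near_coord c q (P : set M) : chart_at c q -> (\forall q' \near q, P q') ->
  \forall y \near coord c q, exists q', [/\ chart_at c q', coord c q' = y & P q'].
Proof.
move=> [ac cq] nP.
pose A := cdom c `&` interior P.
have oA : open A by apply: openI; [exact: (cm_dom_open (cmP M)) | exact: open_interior].
have Ac : A `<=` cdom c by move=> ? [].
have oIA := (cm_homeo (cmP M) ac Ac).1 oA.
have : nbhs (coord c q) (coord c @` A).
  by apply: open_nbhs_nbhs; split=> //; exists q.
apply: filterS => y [q' [cq' Pq'] qy]; exists q'; split=> //.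
exact: interior_subset.
Qed.

Lemma chart_coord_continuous c q : chart_at c q -> {for q, continuous (coord c)}.
Proof.
move=> [ac cq] U; rewrite /= nbhsE => -[W [oW Wq] WU].
pose A := cdom c `&` coord c @^-1` W.
have AW : coord c @` A = coord c @` cdom c `&` W.
  apply/seteqP; split=> [y [p [cp Wp] <-]|y [[p cp <-] Wp]]; last by exists p.
  by split=> //; exists p.
have oA : open A.
  apply: (cm_homeo (cmP M) ac _).2; first by move=> ? [].
  by rewrite AW; apply: openI => //; exact: (cm_img_open (cmP M)).
have : nbhs q A by apply: open_nbhs_nbhs; split.
by apply: filterS => p [_ /WU].
Qed.

Lemma near_chart_at c q : chart_at c q -> \forall q' \near q, chart_at c q'.
Proof.
move=> [ac cq]; have : nbhs q (cdom c).
  by apply: open_nbhs_nbhs; split=> //; exact: (cm_dom_open (cmP M)).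
by apply: filterS => p cp; split.
Qed.

Context {m : nat} (N : charted R m).

Definition lmap (c : chart R n M) (d : chart R m N) (f : M -> N)
    (y : Cn R n) : Cn R m :=
  (\row_k complex.Re (lrep c (fun q => zc d k (f q)) y),
   \row_k complex.Im (lrep c (fun q => zc d k (f q)) y)).

Lemma dzv_lmap c (d : chart R m N) (f : M -> N) y k :
  dzv (lmap c d f y) 0 k = lrep c (fun q => zc d k (f q)) y.
Proof. by rewrite !mxE /=; case: lrep. Qed.

Lemma lmapE c (d : chart R m N) (f : M -> N) q :
  chart_at c q -> lmap c d f (coord c q) = coord d (f q).
Proof.
move=> cq; rewrite /lmap [RHS]surjective_pairing.
by congr (_, _); apply/rowP => k; rewrite mxE chart_lrepE // /zc mxE.
Qed.

Section Comp.
Variables (c : chart R n M) (d : chart R m N) (f : M -> N) (g : N -> R[i]) (x : M).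
Hypothesis id_ : set_inj (cdom d) (coord d).

Lemma near_lrep_comp : chart_at c x -> (\forall q \near x, cdom d (f q)) ->
  \forall y \near coord c x, lrep c (fun q => g (f q)) y = lrep d g (lmap c d f y).
Proof.
move=> cx /(near_coord cx); apply: filterS => y [q [cq <- dq]].
by rewrite chart_lrepE // lmapE // lrepE.
Qed.

Hypothesis cx : chart_at c x.
Hypothesis fd : \forall q \near x, cdom d (f q).
Hypothesis df : forall k, cdifferentiable (lrep c (fun q => zc d k (f q))) (coord c x).
Hypothesis dg : cdifferentiable (lrep d g) (coord d (f x)).

Let df' k : cdifferentiable (fun y => dzv (lmap c d f y) 0 k) (coord c x).
Proof.
rewrite (_ : (fun y => _) = lrep c (fun q => zc d k (f q))); first exact: df.
by apply/funext => y; rewrite dzv_lmap.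
Qed.

Lemma dzv_derive_lmap v k :
  dzv ('D_v (lmap c d f) (coord c x)) 0 k = dv c v (fun q => zc d k (f q)) x.
Proof.
rewrite dzv_derive // /dv; congr (cD v _ _).
by apply/funext => y; rewrite dzv_lmap.
Qed.

Lemma dv_comp v : dv c v (fun q => g (f q)) x =
  cD ('D_v (lmap c d f) (coord c x)) (lrep d g) (coord d (f x)).
Proof.
rewrite /dv (cD_near _ (near_lrep_comp cx fd)) cD_comp ?lmapE //.
Qed.

Lemma cdifferentiable_lrep_comp :
  cdifferentiable (lrep c (fun q => g (f q))) (coord c x).
Proof.
apply: (cdifferentiable_near (f := fun y => lrep d g (lmap c d f y))).
  by move: (near_lrep_comp cx fd); apply: filterS => y ->.
have dT := differentiable_from_co (@ccoord_sum R m) (differentiable_ccoord df').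
have [dr di] := dg; rewrite -(lmapE d f cx) in dr di.
by split; [exact: (differentiable_comp dT dr) | exact: (differentiable_comp dT di)].
Qed.

End Comp.

Lemma csmooth_lrep_comp c (d : chart R m N) (f : M -> N) (g : N -> R[i]) A B :
  set_inj (cdom d) (coord d) ->
  atlas c -> open A -> A `<=` cdom c -> (forall q, A q -> cdom d (f q)) ->
  (forall k, csmooth (coord c @` A) (lrep c (fun q => zc d k (f q)))) ->
  csmooth B (lrep d g) -> (forall q, A q -> B (coord d (f q))) ->
  csmooth (coord c @` A) (lrep c (fun q => g (f q))).
Proof.
move=> id_ ac oA Ac Ad sf sg AB.
have oI := (cm_homeo (cmP M) ac Ac).1 oA.
have E : forall y, (coord c @` A) y -> lrep d g (lmap c d f y) = lrep c (fun q => g (f q)) y.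
  move=> _ [q Aq <-]; have cq : chart_at c q by split=> //; exact: Ac.
  by rewrite lmapE // chart_lrepE // lrepE //; exact: Ad.
apply: (csmooth_ext oI E).
apply: (csmooth_comp oI _ sg) => [_ [q Aq <-]|k].
  by rewrite lmapE; [exact: AB | split=> //; exact: Ac].
rewrite (_ : (fun y => _) = lrep c (fun q => zc d k (f q))) //.
by apply/funext => y; rewrite dzv_lmap.
Qed.

End LocalRepresentatives.

Section ChartInverse.
Context {R : realType} {n : nat} (M : complexManifold R n).
Implicit Types (c : chart R n M) (q x : M).

(** [x0] is a default value outside the image of the chart. *)
Definition cinv c (x0 : M) (y : Cn R n) : M :=
  xget x0 [set q | chart_at c q /\ coord c q = y].

Lemma cinvK c x0 q : chart_at c q -> cinv c x0 (coord c q) = q.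
Proof.
move=> cq; rewrite /cinv; case: xgetP => [p _ [cp pq]|/(_ q)]; last by case.
by apply: (cm_inj (cmP M) cp.1) => //; rewrite inE; [exact: cp.2 | exact: cq.2].
Qed.

Lemma cinv_continuous c x0 q : chart_at c q ->
  {for coord c q, continuous (cinv c x0)}.
Proof.
move=> cq U; rewrite cinvK // => /(near_coord cq); apply: filterS.
by move=> y [p [cp <- Up]]; rewrite /= cinvK.
Qed.

Lemma manifold_locally_path_connected : locally_path_connected R M.
Proof.
move=> x W nW; have [c cx] := cm_cover (cmP M) x.
have /nbhs_ballP[r /= r0 Hr] := near_coord cx nW.
have nB : nbhs (coord c x) (ball (coord c x) r) by exact: nbhsx_ballx.
have nBx : \forall y \near x, ball (coord c x) r (coord c y).
  exact: (chart_coord_continuous cx nB).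
move: (near_chart_at cx) nBx; apply: filterS2 => y cy Br.
pose cl (t : R) := Num.min 1 (Num.max 0 t).
have cl01 t : 0 <= cl t <= 1.
  by rewrite /cl le_min ler01 le_max lexx /= ge_min lexx.
pose l t := coord c x + cl t *: (coord c y - coord c x).
have lB t : ball (coord c x) r (l t) by exact: ball_line.
have cl_cont : continuous l.
  move=> t; apply: cvgD; first exact: cvg_cst.
  apply: cvgZr_tmp; apply: continuous_min; first exact: cvg_cst.
  by apply: continuous_max; [exact: cvg_cst | exact: cvg_id].
exists (fun t => cinv c x (l t)); split.
- move=> t; apply: continuous_comp; first exact: cl_cont.
  have [q [cq <- _]] := Hr _ (lB t); exact: cinv_continuous.
- by rewrite /l /cl maxxx (min_idPr ler01) scale0r addr0 cinvK.
- by rewrite /l /cl (max_idPr ler01) minxx scale1r addrC subrK cinvK.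
- by move=> t; have [q [cq <- Wq]] := Hr _ (lB t); rewrite cinvK.
Qed.

End ChartInverse.

Section CotangentChart.
Context {R : realType} {n : nat} (L : complexManifold R n).

Lemma cotangent_ext (xi zeta : cotangent L) : cot_base xi = cot_base zeta ->
  (forall c, chart_at c (cot_base xi) -> cot_comp xi c = cot_comp zeta c) ->
  xi = zeta.
Proof.
case: xi zeta => [x a Ha Ha'] [y b Hb Hb'] /= xy; subst y => ab.
have ab' : a = b.
  apply/funext => c; have [cx|ncx] := pselect (chart_at c x); first exact: ab.
  by rewrite Ha' // Hb'.
subst b; congr Cotangent; exact: Prop_irrelevance.
Qed.

Lemma cot_chart_inj (c : chart R n L) : atlas c ->
  set_inj (cdom (cot_chart c)) (coord (cot_chart c)).
Proof.
move=> ac xi zeta; rewrite !inE /= => cxi czeta [].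
move=> /eq_row_mx [E1 E2] /eq_row_mx [E3 E4].
have bE : cot_base xi = cot_base zeta.
  apply: (cm_inj (cmP L) ac); rewrite ?inE //.
  by rewrite (surjective_pairing (coord c (cot_base xi))) E1 E3 -surjective_pairing.
have cE : cot_comp xi c = cot_comp zeta c.
  apply/rowP => j; move/rowP/(_ j) : E2; move/rowP/(_ j) : E4; rewrite !mxE.
  by case: (cot_comp xi c 0 j) (cot_comp zeta c 0 j) => a b [a' b'] /= -> ->.
apply: cotangent_ext => // d dxi.
have cxi' : chart_at c (cot_base xi) by split.
rewrite (cot_compat dxi cxi') cE bE -cot_compat //; rewrite -bE //.
Qed.

End CotangentChart.

(** * Potentials of the form [-2 Im eta] *)

Section PotentialForm.
Context {R : realType} {n : nat} (L : complexManifold R n).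
Variable eta : L -> Tstar L.
Hypothesis eta_smooth : smooth_map [set: L] eta.
Hypothesis eta_base : forall x, cot_base (eta x) = x.
Implicit Types (c d : chart R n L) (x : L) (f g : L -> R).

Definition acomp c (j : 'I_n) (q : L) : R[i] := cot_comp (eta q) c 0 j.

Lemma cot_chart_at c x : chart_at c x -> @chart_at R (n + n) (Tstar L) (cot_chart c) (eta x).
Proof. by move=> [ac cx]; split; [exists c | rewrite /= eta_base]. Qed.

Lemma zc_eta_base c j q : zc (M := Tstar L) (cot_chart c) (lshift n j) (eta q) = zc c j q.
Proof. by rewrite /zc [LHS]mxE [RHS]mxE /= !row_mxEl eta_base. Qed.

Lemma zc_eta_comp c j q : zc (M := Tstar L) (cot_chart c) (rshift n j) (eta q) = acomp c j q.
Proof. by rewrite /zc mxE /= !row_mxEr !mxE /acomp; case: (cot_comp _ _ _ _). Qed.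

Lemma csmooth_eta c k : atlas c ->
  csmooth (coord c @` cdom c) (lrep c (fun q => zc (M := Tstar L) (cot_chart c) k (eta q))).
Proof.
move=> ac; have [_ /(_ (cot_chart c)) H] := eta_smooth.
have acc : @atlas _ _ (Tstar L) (cot_chart c) by exists c.
have := H acc k c ac; congr (csmooth (_ @` _) _).
by apply/seteqP; split=> [q []|q cq] //; do !split => //=; rewrite eta_base.
Qed.

Lemma csmooth_acomp c j : atlas c ->
  csmooth (coord c @` cdom c) (lrep c (acomp c j)).
Proof.
move=> ac; have := csmooth_eta (rshift n j) ac; congr (csmooth _ (lrep c _)).
by apply/funext => q; rewrite zc_eta_comp.
Qed.

(** The components, in the real coordinates of the chart [c], of the real
    1-form [-2 Im eta], which is to be [dK]. *)
Definition pform c (i : 'I_n + 'I_n) (y : Cn R n) : R :=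
  match i with
  | inl j => - 2 * complex.Im (lrep c (acomp c j) y)
  | inr j => - 2 * complex.Re (lrep c (acomp c j) y)
  end.

Lemma smooth_pform c i : atlas c -> smooth (coord c @` cdom c) (pform c i).
Proof.
move=> ac k; have oI := cm_img_open (cmP L) ac.
by case: i => j; have [sr si] := csmooth_acomp j ac;
  apply: (Ck_mul oI (Ck_cst _ _ _)).
Qed.

Lemma pformE c x v : chart_at c x ->
  \sum_i ccoord i v * pform c i (coord c x) =
    - 2 * complex.Im (\sum_j acomp c j x * dzv v 0 j).
Proof.
move=> cx; rewrite sum_I Im_sum mulr_sumr -big_split /=; apply: eq_bigr => j _.
rewrite !chart_lrepE // mxE; case: (acomp c j x) => a b /=; ring.
Qed.

Definition rlrep c f (y : Cn R n) : R := complex.Re (lrep c (fun q => (f q)%:C%C) y).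

Lemma rlrepE c f q : chart_at c q -> rlrep c f (coord c q) = f q.
Proof. by move=> cq; rewrite /rlrep chart_lrepE. Qed.

Lemma Im_lrep_real c f y : complex.Im (lrep c (fun q => (f q)%:C%C) y) = 0.
Proof. by rewrite /lrep; case: xgetP => [_ _ [q _ <-]|]. Qed.

Lemma cdifferentiable_rlrep c f y : differentiable (rlrep c f) y ->
  cdifferentiable (lrep c (fun q => (f q)%:C%C)) y.
Proof.
move=> df; split=> //.
rewrite (_ : (fun y => _) = cst 0); first exact: differentiable_cst.
by apply/funext => z; exact: Im_lrep_real.
Qed.

Definition is_potential f x := forall c, chart_at c x ->
  differentiable (rlrep c f) (coord c x) /\
  forall v, 'D_v (rlrep c f) (coord c x) =
    \sum_i ccoord i v * pform c i (coord c x).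

Lemma is_potential_chart f x d : chart_at d x ->
  differentiable (rlrep d f) (coord d x) ->
  (forall v, 'D_v (rlrep d f) (coord d x) =
    \sum_i ccoord i v * pform d i (coord d x)) ->
  is_potential f x.
Proof.
move=> dx df Df c cx.
have id_ : set_inj (cdom d) (coord d) by exact: cm_inj (cmP L) _ dx.1.
have holo k := cm_trans (cmP L) cx.1 dx.1 k.
have fd : \forall q \near x, cdom d q by move: (near_chart_at dx); apply: filterS => q [].
have dT k : cdifferentiable (lrep c (fun q => zc d k q)) (coord c x).
  apply: csmooth_cdifferentiable ((holo k).1 c cx.1) _.
  by exists x => //; split; [exact: cx.2 | split; [exact: cx.2 | exact: dx.2]].
have dg := cdifferentiable_rlrep df.
split.
  exact: (cdifferentiable_lrep_comp id_ cx fd dT dg).1.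
move=> v.
have := dv_comp id_ cx fd dT dg v => /(congr1 (@complex.Re R)) /= E.
apply: eq_trans E _.
rewrite Df !pformE //; congr (_ * complex.Im _).
under eq_bigr => k _.
  rewrite dzv_derive_lmap // /dv cD_wirt //.
  under eq_bigr => j _.
    have -> : wirtb j (lrep c (fun q => zc d k q)) (coord c x) = 0.
      by apply: (holo k).2 => //; split; [exact: cx.2 | exact: dx.2].
    rewrite mul0r addr0; over.
  rewrite mulr_sumr; over.
rewrite exchange_big /=; apply: eq_bigr => j _.
under eq_bigr => k _ do rewrite mulrA.
rewrite -mulr_suml; congr (_ * _).
have cx' : chart_at c (cot_base (eta x)) by rewrite eta_base.
have dx' : chart_at d (cot_base (eta x)) by rewrite eta_base.
rewrite [RHS]/acomp (cot_compat cx' dx') mxE; apply: eq_bigr => k _.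
by rewrite !mxE eta_base.
Qed.

Lemma is_potential_shift f g x (a : R) : (\forall y \near x, g y = f y + a) ->
  is_potential f x -> is_potential g x.
Proof.
move=> gf pf c cx; have [df Df] := pf c cx.
have near_g : \forall y \near coord c x, rlrep c f y + a = rlrep c g y.
  move: (near_coord cx gf); apply: filterS => y [q [cq <- E]].
  by rewrite !rlrepE.
split.
  apply: near_eq_differentiable near_g _.
  by apply: differentiableD.
move=> v; rewrite -Df -(near_eq_derive _ near_g).
rewrite (@deriveD _ _ _ (rlrep c f) (cst a)) //; first by rewrite derive_cst addr0.
exact: diff_derivable.
Qed.

Lemma is_potential_eq f g y :
  (\forall z \near y, is_potential f z) -> (\forall z \near y, is_potential g z) ->
  \forall z \near y, f z - f y = g z - g y.
Proof.
move=> pf pg; have [c cy] := cm_cover (cmP L) y.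
have /nbhs_ballP[r /= r0 Hr] : \forall w \near coord c y, exists q,
    [/\ chart_at c q, coord c q = w & is_potential f q /\ is_potential g q].
  by apply: (near_coord cy); exact: filterI.
have nB : \forall z \near y, ball (coord c y) r (coord c z).
  by apply: (chart_coord_continuous cy); exact: nbhsx_ballx.
move: (near_chart_at cy) nB; apply: filterS2 => z cz Bz.
have := @derive0_ball_cst R _ (rlrep c f - rlrep c g) (coord c y) r _ _ Bz.
rewrite !fctE /= !rlrepE // => H.
suff : f z - g z = f y - g y by lra.
apply: H => w /Hr[q [cq <- [/(_ c cq)[df Df] /(_ c cq)[dg Dg]]]].
split=> [|v]; first exact: differentiableB.
by rewrite deriveB ?Df ?Dg ?subrr //; exact: diff_derivable.
Qed.

Hypothesis pform_closed : forall c x i j, chart_at c x ->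
  'D_(cbas i) (pform c j) (coord c x) = 'D_(cbas j) (pform c i) (coord c x).

Lemma local_potential x : exists f, \forall y \near x, is_potential f y.
Proof.
have [c cx] := cm_cover (cmP L) x.
have ac := cx.1.
have oI := cm_img_open (cmP L) ac.
have /nbhs_ballP[r /= r0 Hr] : nbhs (coord c x) (coord c @` cdom c).
  by apply: open_nbhs_nbhs; split=> //; exists x => //; exact: cx.2.
have [|||phi Hphi] := @poincare _ _ _ _ _ (@ccoord_le R n) (@ccoord_sum R n)
  (coord c x) r (pform c).
- by move=> i y /Hr Iy; exact: (smooth_pform i ac 1).1.
- by move=> i j y /Hr Iy; exact: ((smooth_pform i ac 1).2 (cbas j)).
- by move=> i j y /Hr[q cq <-]; apply: pform_closed.
exists (fun q => phi (coord c q)).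
have nB : \forall z \near x, ball (coord c x) r (coord c z).
  by apply: (chart_coord_continuous cx); exact: nbhsx_ballx.
move: (near_chart_at cx) nB; apply: filterS2 => z cz Bz.
have [dphi Dphi] := Hphi _ Bz.
have near_phi : \forall y \near coord c z, phi y = rlrep c (fun q => phi (coord c q)) y.
  move: (near_coord cz (near_chart_at cz)); apply: filterS => y [q [cq <- _]].
  by rewrite rlrepE.
apply: (is_potential_chart cz).
  exact: near_eq_differentiable near_phi dphi.
by move=> v; rewrite -Dphi; symmetry; apply: near_eq_derive.
Qed.

Lemma global_potential : connected [set: L] -> simply_connected R [set: L] ->
  exists K, forall x, is_potential K x.
Proof.
move=> conn sc.
have [F HF] := choice local_potential.
have nn x : \forall y \near x, \forall z \near y, is_potential (F x) z.
  exact: nbhs_interior (HF x).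
have [|K HK] := @global_primitive R L F _ conn sc (@manifold_locally_path_connected R n L).
  by move=> x; move: (nn x); apply: filterS => y Fxy; exact: is_potential_eq.
exists K => x; apply: (@is_potential_shift (F x) _ _ (K x - F x x)); last first.
  exact: nbhs_singleton (HF x).
by move: (HK x); apply: filterS => y E; lra.
Qed.

End PotentialForm.

(** * Pullback of the symplectic form *)

Section Tangent.
Context {R : realType} {m n : nat} (M : complexManifold R m) (N : complexManifold R n).
Variable f : M -> N.
Hypothesis f_continuous : continuous f.
Hypothesis f_smooth : forall c d k, atlas c -> atlas d ->
  csmooth (coord c @` (cdom c `&` f @^-1` cdom d)) (lrep c (fun q => zc d k (f q))).

Lemma Ck_affine (A : set R^o) (a b : R) k : open A ->
  Ck (V := R^o) k A (fun t : R^o => a + t * b).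
Proof.
move=> oA; apply: Ck_add => //; first exact: Ck_cst.
apply: Ck_mul => //; last exact: Ck_cst.
case: k => [|k] /=; first by move=> x _; exact: cvg_id.
split=> [x _|v]; first exact: ex_diff.
rewrite (_ : (fun x => _) = (fun=> v)); first exact: Ck_cst.
by apply/funext => x; rewrite derive_id.
Qed.

Lemma tangent_push (S : set N) c d x (v : Cn R m) : range f `<=` S ->
  chart_at c x -> chart_at d (f x) -> tangent S d (f x) (push c d f x v).
Proof.
move=> fS cx dfx.
pose p := coord c x.
pose l (t : R^o) := p + (t : R) *: v.
have l_cont : continuous l.
  by move=> t; apply: cvgD; [exact: cvg_cst | apply: cvgZr_tmp; exact: cvg_id].
have nI : nbhs p (coord c @` cdom c).
  apply: open_nbhs_nbhs; split; first exact: cm_img_open (cmP M) _ cx.1.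
  by exists x => //; exact: cx.2.
have l0 : l 0 = p by rewrite /l scale0r addr0.
have /nbhs_ballP[e /= e0 He] : \forall t \near (0 : R^o), (coord c @` cdom c) (l t).
  by apply: l_cont; rewrite l0.
have Je t : `]- e, e[%classic t -> exists2 q, chart_at c q & coord c q = l t.
  rewrite /= in_itv /= => te; have [|q cq ql] := He t.
    by rewrite -ball_normE /= sub0r normrN ltr_norml.
  by exists q => //; split=> //; exact: cx.1.
pose g (t : R) := f (cinv c x (l t)).
have g_cont t : `]- e, e[%classic t -> {for t, continuous g}.
  move=> /Je[q cq ql]; apply: (@continuous_comp _ _ _ (fun t => cinv c x (l t)) f).
    apply: (@continuous_comp _ _ _ l (cinv c x)); first exact: l_cont.
    by rewrite -ql; exact: cinv_continuous.
  exact: f_continuous.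
have g0 : g 0 = f x by rewrite /g l0 cinvK.
exists g, e; split=> //.
- split=> [t /g_cont //|d' ad' k].
  pose A := `]- e, e[%classic `&` g @^-1` cdom d'.
  have oA : open (A : set R^o).
    rewrite openE => t [Jt dt].
    have [q cq ql] := Je t Jt.
    have nJ : nbhs t `]- e, e[%classic by apply: open_nbhs_nbhs; split=> //; exact: interval_open.
    have nd : nbhs t (g @^-1` cdom d').
      apply: (g_cont t Jt); apply: open_nbhs_nbhs; split=> //.
      exact: cm_dom_open (cmP N) _ ad'.
    exact: filterI.
  have gE t : A t -> lrep c (fun q => zc d' k (f q)) (l t) = zc d' k (g t).
    by move=> [/Je[q cq ql] _]; rewrite /g -ql chart_lrepE // cinvK.
  apply: (csmooth_ext (V := R^o) oA gE).
  apply: (csmooth_comp (V := R^o) oA _ (f_smooth k cx.1 ad')) => [t [Jt dt]|j].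
    have [q cq ql] := Je t Jt; exists q => //; split; first exact: cq.2.
    by move: dt; rewrite /= /g -ql cinvK.
  split=> i.
    rewrite (_ : (fun y => _) = (fun t : R^o => p.1 0 j + t * v.1 0 j)).
      exact: Ck_affine.
    by apply/funext => t; rewrite !mxE.
  rewrite (_ : (fun y => _) = (fun t : R^o => p.2 0 j + t * v.2 0 j)).
    exact: Ck_affine.
  by apply/funext => t; rewrite !mxE.
- by move=> t _; apply: fS; exists (cinv c x (l t)).
- apply/rowP => k; rewrite !mxE.
  have nE : \forall t \near (0 : R^o), lrep c (fun q => zc d k (f q)) (l t) = zc d k (g t).
    apply/nbhs_ballP; exists e => //= t; rewrite -ball_normE /= sub0r normrN => te.
    have [|q cq ql] := Je t; first by rewrite /= in_itv /= -ltr_norml.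
    by rewrite /g -ql chart_lrepE // cinvK.
  have cdF : cdifferentiable (lrep c (fun q => zc d k (f q))) p.
    apply: csmooth_cdifferentiable (f_smooth k cx.1 dfx.1) _.
    by exists x => //; split; [exact: cx.2 | exact: dfx.2].
  rewrite -(cD_near (V := R^o) 1 nE) /dv /cD -/p.
  have [dr di] := cdF.
  have E (F : Cn R m -> R) : differentiable F p ->
      'D_v F p = 'D_(1 : R^o) (fun t : R^o => F (l t)) 0.
    move=> dF; have [|_ ->] := @is_derive_line R _ F p v 0.
      by apply: diff_derivable; rewrite scale0r addr0.
    by rewrite scale0r addr0.
  by rewrite (E _ dr) (E _ di).
Qed.

End Tangent.

Section Pullback.
Context {R : realType} {n : nat} (Z : symplecticManifold R n) (L : complexManifold R n).
Variables (U : set (Tstar L)) (phi : Tstar L -> Z) (eta : L -> Tstar L).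
Hypothesis phi_iso : open_holo_iso U phi.
Hypothesis phi_symplectic : forall c d xi, U xi -> chart_at c xi -> chart_at d (phi xi) ->
  jac c d phi xi *m @sm_form R n Z d (phi xi) *m (jac c d phi xi)^T = @Om0 R n L c xi.
Hypothesis eta_smooth : smooth_map [set: L] eta.
Hypothesis eta_base : forall x, cot_base (eta x) = x.
Hypothesis eta_U : forall x, U (eta x).

Let psi x := phi (eta x).

Lemma cdifferentiable_dzv (x : Cn R n) k : cdifferentiable (fun y : Cn R n => dzv y 0 k) x.
Proof.
split.
  rewrite (_ : (fun y => _) = ccoord (inl k)).
    exact: (differentiable_co (@ccoord_le R n)).
  by apply/funext => y; rewrite mxE.
rewrite (_ : (fun y => _) = ccoord (inr k)).
  exact: (differentiable_co (@ccoord_le R n)).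
by apply/funext => y; rewrite mxE.
Qed.

Lemma dv_zc c x v k : chart_at c x -> dv (M := L) c v (zc c k) x = dzv v 0 k.
Proof.
move=> cx.
have nE : \forall y \near coord c x, lrep c (zc c k) y = dzv y 0 k.
  move: (near_coord cx (near_chart_at cx)); apply: filterS => y [q [cq <- _]].
  by rewrite chart_lrepE.
rewrite /dv (cD_near v nE).
rewrite -(@dzv_derive R n _ id); first by rewrite derive_id.
by move=> j; exact: cdifferentiable_dzv.
Qed.

Lemma push_eta c x v : chart_at c x ->
  push (N := Tstar L) c (cot_chart c) eta x v =
  row_mx (dzv v) (\row_j dv c v (acomp eta c j) x).
Proof.
move=> cx; apply/rowP => k; rewrite !mxE; case: splitP => j kj.
  have -> : k = lshift n j by exact/val_inj.
  rewrite -(dv_zc v j cx); congr (dv c v _ x).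
  by apply/funext => q; exact: zc_eta_base.
have -> : k = rshift n j by exact/val_inj.
rewrite mxE; congr (dv c v _ x).
by apply/funext => q; exact: zc_eta_comp.
Qed.

Lemma psi_continuous : continuous psi.
Proof.
move=> x; apply: (@continuous_comp _ _ _ eta phi); first exact: eta_smooth.1.
by have [_ [[+ _] _]] := phi_iso; apply; exact: eta_U.
Qed.

Lemma psi_smooth c d k : atlas c -> atlas d ->
  csmooth (coord c @` (cdom c `&` psi @^-1` cdom d)) (lrep c (fun q => zc d k (psi q))).
Proof.
move=> ac ad.
have [_ [[_ /(_ d ad k)[sphi _]] _]] := phi_iso.
have ae : @atlas _ _ (Tstar L) (cot_chart c) by exists c.
apply: (csmooth_lrep_comp (N := Tstar L) (d := cot_chart c)
  (cot_chart_inj ac) ac _ _ _ _ (sphi _ ae)).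
- apply: openI; first exact: cm_dom_open (cmP L) _ ac.
  apply: open_comp; first by move=> x _; exact: psi_continuous.
  exact: cm_dom_open (cmP Z) _ ad.
- by move=> q [].
- by move=> q [cq _] /=; rewrite eta_base.
- move=> j; have [sr si] := csmooth_eta eta_smooth eta_base j ac.
  by split=> i; [move: (sr i) | move: (si i)]; apply: Ck_sub => _ [q [cq _] <-]; exists q.
- move=> q [cq dq]; exists (eta q) => //; split; first by rewrite /= eta_base.
  by split.
Qed.

Lemma push_psi c d x v : chart_at c x -> chart_at d (psi x) ->
  push c d psi x v = push (N := Tstar L) c (cot_chart c) eta x v
    *m jac (M := Tstar L) (cot_chart c) d phi (eta x).
Proof.
move=> cx dx; apply/rowP => k; rewrite !mxE.
have [_ [[_ /(_ d dx.1 k)[sphi hphi]] _]] := phi_iso.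
have ae : @atlas _ _ (Tstar L) (cot_chart c) by exists c; [exact: cx.1|].
have fd : \forall q \near x, cdom (cot_chart c) (eta q).
  by move: (near_chart_at cx); apply: filterS => q [_ cq]; rewrite /= eta_base.
have df j : cdifferentiable
      (lrep c (fun q => zc (M := Tstar L) (cot_chart c) j (eta q))) (coord c x).
  apply: csmooth_cdifferentiable (csmooth_eta eta_smooth eta_base j cx.1) _.
  by exists x => //; exact: cx.2.
have dg : cdifferentiable (lrep (M := Tstar L) (cot_chart c) (fun xi => zc d k (phi xi)))
    (coord (cot_chart c) (eta x)).
  apply: csmooth_cdifferentiable (sphi _ ae) _.
  exists (eta x) => //; split; first by rewrite /= eta_base; exact: cx.2.
  by split; [exact: eta_U | exact: dx.2].
rewrite (dv_comp (N := Tstar L) (g := fun xi => zc d k (phi xi))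
  (cot_chart_inj cx.1) cx fd df dg).
rewrite cD_wirt //; apply: eq_bigr => j _.
rewrite (dzv_derive_lmap (N := Tstar L) df) !mxE.
rewrite (_ : wirtb j _ _ = 0) ?mul0r ?addr0; first by rewrite mulrC.
apply: hphi; first exact: cot_chart_at.
by split; [exact: eta_U | exact: dx.2].
Qed.

Lemma pullback_OmE c d x v w : chart_at c x -> chart_at d (psi x) ->
  pullback_Om psi c d x v w =
    \sum_j (dv c v (acomp eta c j) x * dzv w 0 j - dv c w (acomp eta c j) x * dzv v 0 j).
Proof.
move=> cx dx; rewrite /pullback_Om !(push_psi _ cx dx) /form2_eval.
rewrite trmx_mul !mulmxA -(mulmxA _ (jac _ _ _ _)) -(mulmxA _ (_ *m _)).
rewrite (phi_symplectic (eta_U x) (cot_chart_at eta_base cx) dx) /Om0.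
rewrite !push_eta // mul_row_block tr_row_mx mul_row_col.
rewrite !mulmx0 add0r addr0 mulmx1 mulmxN mulmx1 mulNmx !mxE -sumrB.
apply: eq_bigr => j _; rewrite !mxE; congr (_ - _); exact: mulrC.
Qed.

Lemma Im_pullback_Om (S : set Z) c d x v w : lagrangian_Im S -> range psi `<=` S ->
  chart_at c x -> chart_at d (psi x) -> complex.Im (pullback_Om psi c d x v w) = 0.
Proof.
move=> lagS psiS cx dx.
have T u : tangent S d (psi x) (push c d psi x u).
  exact: (tangent_push psi_continuous psi_smooth).
by apply: (lagS d (psi x) dx _ _).1; [apply: psiS; exists x | exact: T | exact: T].
Qed.

Lemma Im_mul_dzv (z : R[i]) (v : Cn R n) j :
  complex.Im (z * dzv v 0 j) = complex.Re z * v.2 0 j + complex.Im z * v.1 0 j.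
Proof. by rewrite mxE; case: z. Qed.

Lemma lagrangian_pform_closed (S : set Z) : lagrangian_Im S -> range psi `<=` S ->
  forall c x i j, chart_at c x ->
  'D_(cbas i) (pform eta c j) (coord c x) = 'D_(cbas j) (pform eta c i) (coord c x).
Proof.
move=> lagS psiS c x i j cx.
have D k v : \sum_j complex.Im (dv c v (acomp eta c j) x * dzv (cbas k) 0 j) =
    - 2^-1 * 'D_v (pform eta c k) (coord c x).
  have dA l : cdifferentiable (lrep c (acomp eta c l)) (coord c x).
    apply: csmooth_cdifferentiable (csmooth_acomp eta_smooth eta_base l cx.1) _.
    by exists x => //; exact: cx.2.
  have Dk : 'D_v (pform eta c k) (coord c x) = match k with
     | inl l => - 2 * complex.Im (dv c v (acomp eta c l) x)
     | inr l => - 2 * complex.Re (dv c v (acomp eta c l) x) end.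
    by case: k => l; have [dr di] := dA l;
      apply: deriveZ; apply: diff_derivable.
  rewrite Dk {Dk}.
  have F l : complex.Im (dv c v (acomp eta c l) x * dzv (cbas k) 0 l) =
      complex.Re (dv c v (acomp eta c l) x) * ccoord (inr l) (cbas k) +
      complex.Im (dv c v (acomp eta c l) x) * ccoord (inl l) (cbas k).
    exact: Im_mul_dzv.
  under eq_bigr => l _ do rewrite F !ccoord_bas.
  case: k {F} => l; rewrite (bigD1 l) //= big1 ?addr0 => [|l' l'l].
  - rewrite eqxx mulr0 mulr1 add0r; move: ('D_v _ _) => b; by field.
  - by rewrite (inj_eq (@inl_inj _ _)) (negbTE l'l) !mulr0 addr0.
  - rewrite eqxx mulr0 mulr1 addr0; move: ('D_v _ _) => b; by field.
  - by rewrite (inj_eq (@inr_inj _ _)) (negbTE l'l) !mulr0 addr0.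
have half_inj (a b : R) : - 2^-1 * a - - 2^-1 * b = 0 -> a = b by lra.
have [d dx] := cm_cover (cmP Z) (psi x).
have := Im_pullback_Om (cbas i) (cbas j) lagS psiS cx dx.
rewrite pullback_OmE //.
have ImB (a b : R[i]) : complex.Im (a - b) = complex.Im a - complex.Im b.
  by case: a b => ? ? [].
have key (A B : 'I_n -> R[i]) :
    complex.Im (\sum_l (A l - B l)) = \sum_l complex.Im (A l) - \sum_l complex.Im (B l).
  by rewrite Im_sum -sumrB; apply: eq_bigr => l _; exact: ImB.
pose A := (fun l => dv c (cbas i) (acomp eta c l) x * dzv (cbas j) 0 l).
pose B := (fun l => dv c (cbas j) (acomp eta c l) x * dzv (cbas i) 0 l).
move=> H.
exact: half_inj (eq_trans (esym (congr2 (fun a b : R => a - b) (D j (cbas i)) (D i (cbas j))))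
  (eq_trans (esym (key A B)) H)).
Qed.

End Pullback.

(** * The generalized Kaehler potential *)

Section Potentials.
Context {R : realType} {n : nat} (L : complexManifold R n).
Variable eta : L -> Tstar L.
Hypothesis eta_smooth : smooth_map [set: L] eta.
Hypothesis eta_base : forall x, cot_base (eta x) = x.
Implicit Types (c d : chart R n L) (x : L) (f g K : L -> R).

Lemma is_potential_smooth K : (forall x, is_potential eta K x) -> smooth_real K.
Proof.
move=> pK c ac; rewrite setIT; have oI := cm_img_open (cmP L) ac.
split=> k; last first.
  rewrite (_ : (fun y => _) = (fun=> 0)); first exact: Ck_cst.
  by apply/funext => y; exact: Im_lrep_real.
have dK y : (coord c @` cdom c) y -> differentiable (rlrep c K) y.
  by move=> [q cq <-]; have [] := pK q c (conj ac cq).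
change (Ck k (coord c @` cdom c) (rlrep c K)).
case: k => [|k]; first by move=> y /dK; exact: differentiable_continuous.
split=> // v; apply: (@Ck_ext _ _ _ _ (fun y => \sum_i ccoord i v * pform eta c i y)) => //.
  by move=> _ [q cq <-]; have [_ ->] := pK q c (conj ac cq).
apply: Ck_sum => // i; apply: Ck_mul => //; first exact: Ck_cst.
exact: smooth_pform.
Qed.

Lemma smooth_real_differentiable K c x : smooth_real K -> chart_at c x ->
  differentiable (rlrep c K) (coord c x).
Proof.
move=> sK cx; have [/(_ 1%N)[dK _] _] := sK c cx.1; apply: dK.
by exists x => //; split=> //; exact: cx.2.
Qed.

Lemma cD_real K c v y : cD v (lrep c (fun q => (K q)%:C%C)) y = ('D_v (rlrep c K) y)%:C%C.
Proof.
congr (_ +i* _)%C; rewrite (_ : (fun z => _) = cst 0); first exact: derive_cst.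
by apply/funext => z; exact: Im_lrep_real.
Qed.

Lemma minus_i_delE K c x j : minus_i_del K c x 0 j =
  (- (2^-1 * 'D_(ey j) (rlrep c K) (coord c x)) +i*
   - (2^-1 * 'D_(ex j) (rlrep c K) (coord c x)))%C.
Proof.
rewrite mxE /dz /wirt !cD_real.
move: ('D_(ex j) _ _) ('D_(ey j) _ _) => a b.
have -> : 2^-1 = (2^-1)%:C%C :> R[i] by rewrite -[2 in RHS]/(2%:R) fmorphV rmorph_nat.
apply/eqP; rewrite eq_complex /=; apply/andP; split; apply/eqP; ring.
Qed.

Lemma is_potential_minus_i_del K : smooth_real K ->
  (forall x, is_potential eta K x) <->
  (forall c x, chart_at c x -> cot_comp (eta x) c = minus_i_del K c x).
Proof.
move=> sK; split=> [pK c x cx|aK x].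
  have [_ DK] := pK x c cx.
  apply/rowP => j; rewrite minus_i_delE !DK -[ex j]/(cbas (inl j)) -[ey j]/(cbas (inr j)).
  rewrite !sum_ccoord_bas /pform !chart_lrepE // -/(acomp eta c j x).
  case: (acomp eta c j x) => a b; apply/eqP; rewrite eq_complex /=.
  by apply/andP; split; apply/eqP; field.
move=> c cx; have dK := smooth_real_differentiable sK cx; split=> // v.
rewrite (derive_coE (@ccoord_sum R n) _ dK); apply: eq_bigr => i _; congr (_ * _).
have H j := congr1 (fun A : 'rV_n => A 0 j) (aK c x cx).
by case: i => j; rewrite /pform /= chart_lrepE // /acomp H minus_i_delE /=; field.
Qed.

Lemma dz_dzb_real K c x j k : (forall y, is_potential eta K y) -> chart_at c x ->
  dz c j (fun y => dzb c k (fun q => (K q)%:C%C) y) x =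
  - 'i%C * ((dzb c j (acomp eta c k) x)^*)%C.
Proof.
move=> pK cx; have ac := cx.1.
have dA : cdifferentiable (lrep c (acomp eta c k)) (coord c x).
  apply: csmooth_cdifferentiable (csmooth_acomp eta_smooth eta_base k cx.1) _.
  by exists x => //; exact: cx.2.
have nE : \forall y \near coord c x,
    (- complex.Im (lrep c (acomp eta c k) y) +i* - complex.Re (lrep c (acomp eta c k) y))%C =
    lrep c (fun y => dzb c k (fun q => (K q)%:C%C) y) y.
  move: (near_coord cx (near_chart_at cx)); apply: filterS => _ [q [cq <- _]].
  rewrite !(chart_lrepE _ cq) /dzb /wirtb !cD_real.
  have [_ DK] := pK q c cq.
  rewrite !DK -[ex k]/(cbas (inl k)) -[ey k]/(cbas (inr k)) !sum_ccoord_bas.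
  rewrite /pform !chart_lrepE //; case: (acomp eta c k q) => a b.
  have -> : 2^-1 = (2^-1)%:C%C :> R[i] by rewrite -[2 in RHS]/(2%:R) fmorphV rmorph_nat.
  by apply/eqP; rewrite eq_complex /=; apply/andP; split; apply/eqP; field.
have D v : cD v (lrep c (fun y => dzb c k (fun q => (K q)%:C%C) y)) (coord c x) =
    - 'i%C * ((cD v (lrep c (acomp eta c k)) (coord c x))^*)%C.
  rewrite -(cD_near v nE) /cD.
  have [dr di] := dA.
  rewrite /= (deriveN (@diff_derivable _ _ _ _ _ v di))
    (deriveN (@diff_derivable _ _ _ _ _ v dr)).
  move: ('D_v _ _) ('D_v _ _) => a b.
  by apply/eqP; rewrite eq_complex /=; apply/andP; split; apply/eqP; ring.
rewrite /dz /wirt !D /dzb /wirtb.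
move: (cD (ex j) _ _) (cD (ey j) _ _) => a b.
rewrite rmorphM rmorphD rmorphM fmorphV rmorph_nat /=.
have -> : (0 +i* (- 1))%C = - 'i%C :> R[i] by apply/eqP; rewrite eq_complex /= oppr0 !eqxx.
by ring.
Qed.

Lemma dz_acomp_sym c x j k : chart_at c x ->
  (forall i i', 'D_(cbas i) (pform eta c i') (coord c x) =
    'D_(cbas i') (pform eta c i) (coord c x)) ->
  dz c j (acomp eta c k) x = dz c k (acomp eta c j) x.
Proof.
move=> cx closed_p.
have dA l : cdifferentiable (lrep c (acomp eta c l)) (coord c x).
  apply: csmooth_cdifferentiable (csmooth_acomp eta_smooth eta_base l cx.1) _.
  by exists x => //; exact: cx.2.
have D v l : cD v (lrep c (acomp eta c l)) (coord c x) =
    ((- 2^-1 * 'D_v (pform eta c (inr l)) (coord c x)) +i*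
     (- 2^-1 * 'D_v (pform eta c (inl l)) (coord c x)))%C.
  have [dr di] := dA l.
  have Er : 'D_v (pform eta c (inr l)) (coord c x) =
      - 2 * 'D_v (fun y => complex.Re (lrep c (acomp eta c l) y)) (coord c x).
    by apply: deriveZ; exact: diff_derivable.
  have Ei : 'D_v (pform eta c (inl l)) (coord c x) =
      - 2 * 'D_v (fun y => complex.Im (lrep c (acomp eta c l) y)) (coord c x).
    by apply: deriveZ; exact: diff_derivable.
  rewrite Er Ei /cD.
  move: ('D_v (fun y => complex.Re _) _) ('D_v (fun y => complex.Im _) _) => a b.
  by congr (_ +i* _)%C; field.
rewrite /dz /wirt !D.
have := closed_p (inl j) (inr k); have := closed_p (inl k) (inr j).
have := closed_p (inl j) (inl k); have := closed_p (inr j) (inr k) => /= -> -> -> ->.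
move: ('D_(ex k) (pform eta c (inl j)) _) ('D_(ey k) (pform eta c (inr j)) _).
move: ('D_(ey j) (pform eta c (inl k)) _) ('D_(ey k) (pform eta c (inl j)) _).
move=> p q r s; congr (_ * _).
by apply/eqP; rewrite eq_complex /=; apply/andP; split; apply/eqP; ring.
Qed.

End Potentials.

(** With [s] and [q] the components of [del eta] and [delbar eta], [P] is
    [d eta]: its (2,0) part vanishes, and being real it equals the conjugate of
    what remains. *)
Lemma symmetric_part_cancels (R : realType) (n : nat) (s q : 'I_n -> 'I_n -> R[i])
    (a b : 'I_n -> R[i]) : (forall j k, s j k = s k j) ->
  let P := \sum_k ((\sum_j (s j k * a j + q j k * ((a j)^*)%C)) * b k
                 - (\sum_j (s j k * b j + q j k * ((b j)^*)%C)) * a k) in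
  complex.Im P = 0 ->
  P = 'i%C * \sum_j \sum_k
        - 'i%C * ((q j k)^*)%C * (a j * ((b k)^*)%C - b j * ((a k)^*)%C).
Proof.
move=> ssym P ImP.
have E1 : P = \sum_k \sum_j q j k * (((a j)^*)%C * b k - ((b j)^*)%C * a k).
  transitivity (\sum_k \sum_j (s j k * (a j * b k) - s j k * (b j * a k)) +
      \sum_k \sum_j q j k * (((a j)^*)%C * b k - ((b j)^*)%C * a k)).
    rewrite -big_split; apply: eq_bigr => k _ /=.
    rewrite !mulr_suml -sumrB -big_split; apply: eq_bigr => j _ /=; ring.
  rewrite (_ : \sum_k \sum_j (s j k * _ - _) = 0) ?add0r //.
  under eq_bigr => k _ do rewrite sumrB.
  rewrite sumrB [X in _ - X]exchange_big /=; apply/eqP; rewrite subr_eq0; apply/eqP.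
  apply: eq_bigr => k _; apply: eq_bigr => j _.
  by rewrite ssym; congr (_ * _); exact: mulrC.
have E2 : P = (P^*)%C by move: ImP; case: P {E1} => x y /= ->; rewrite oppr0.
have ii : 'i%C * - 'i%C = 1 :> R[i].
  by apply/eqP; rewrite eq_complex /=; apply/andP; split; apply/eqP; ring.
rewrite E2 E1 rmorph_sum mulr_sumr.
under eq_bigr => k _ do rewrite rmorph_sum.
rewrite exchange_big /=; apply: eq_bigr => j _.
rewrite mulr_sumr; apply: eq_bigr => k _.
rewrite !mulrA ii mul1r rmorphM rmorphB !rmorphM /= !conjcK.
by [].
Qed.

Theorem theorem5p1 (R : realType) (n mm mp : nat)
  (Xm : poissonManifold R mm) (Xp : poissonManifold R mp)
  (Z : symplecticManifold R n) (pim : Z -> Xm) (pip : Z -> Xp)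
  (hM : morita_equivalence pim pip)
  (BL : set Z) (hBL : brane_bisection pim pip BL)
  (L : complexManifold R n) (i : L -> Z)
  (hLconn : connected [set: L]) (hLsc : simply_connected R [set: L])
  (U : set (Tstar L)) (phi : Tstar L -> Z) (hphi : darboux_chart i U phi)
  (eta : L -> Tstar L) (heta : generic_chart U phi BL eta) :
  exists K : L -> R,
    [/\ smooth_real K,
        in_chart U phi BL = graph10 (minus_i_del K),
        (forall K' : L -> R, smooth_real K' ->
          (in_chart U phi BL = graph10 (minus_i_del K') <->
           exists a : R, forall x, K' x = K x + a)) &
        (forall c d x v w, chart_at c x -> chart_at d (phi (eta x)) ->
          pullback_Om (phi \o eta) c d x v w = i_del_delbar K c x v w)].
Proof.
have [_ _ lagBL] := hBL.
have [_ phi_iso phi_sympl _] := hphi.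
have [eta_smooth eta_base chartE] := heta.
have eta_in x : in_chart U phi BL (eta x) by rewrite chartE; exists x.
have eta_U x : U (eta x) by have [] := eta_in x.
have psiBL : range (phi \o eta) `<=` BL by move=> _ [x _ <-]; have [] := eta_in x.
have closed_p := lagrangian_pform_closed phi_iso phi_sympl eta_smooth eta_base eta_U lagBL psiBL.
have [K pK] := global_potential eta_smooth eta_base closed_p hLconn hLsc.
have sK := is_potential_smooth eta_smooth eta_base pK.
have graphE K' : in_chart U phi BL = graph10 (minus_i_del K') <->
    (forall c x, chart_at c x -> cot_comp (eta x) c = minus_i_del K' c x).
  split=> [E c x cx|E].
    have : graph10 (minus_i_del K') (eta x) by rewrite -E.
    by move=> /(_ c); rewrite eta_base; exact.
  rewrite chartE; apply/seteqP; split=> [_ [x _ <-]|xi Hxi].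
    by move=> c; rewrite eta_base; exact: E.
  exists (cot_base xi) => //; apply: cotangent_ext; first exact: eta_base.
  by move=> c; rewrite eta_base => cx; rewrite E // Hxi.
exists K; split=> //.
- by apply/graphE; apply/(is_potential_minus_i_del eta sK).
- move=> K' sK'; rewrite graphE -(is_potential_minus_i_del eta sK').
  split=> [pK'|[a Ka] x].
    have [[x0 _]|L0] := pselect ([set: L] !=set0); last first.
      by exists 0 => x; exfalso; apply: L0; exists x.
    have loc x : \forall y \near x, K' y - K' x = K y - K x.
      by apply: (is_potential_eq (eta := eta)); apply: nearW.
    exists (K' x0 - K x0).
    suff E : [set x | K' x = K x + (K' x0 - K x0)] = [set: L].
      by move=> x; have : [set: L] x by []; rewrite -E.
    apply: hLconn.
    + by exists x0; rewrite /= addrC subrK.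
    + exists [set x | K' x = K x + (K' x0 - K x0)]; last by rewrite setTI.
      rewrite openE => x Kx; move: (loc x); apply: filterS => y.
      by move: Kx => /= ->; lra.
    + exists [set x | K' x = K x + (K' x0 - K x0)]; last by rewrite setTI.
      rewrite -openC openE => x nKx; move: (loc x); apply: filterS => y Ey Ky.
      by apply: nKx; move: Ey; rewrite /= Ky; lra.
  by apply: is_potential_shift (pK x); apply: nearW => y; rewrite Ka.
- move=> c d x v w cx dx.
  have PE := pullback_OmE phi_iso phi_sympl eta_smooth eta_base eta_U v w cx dx.
  have Im0 := Im_pullback_Om phi_iso eta_smooth eta_base eta_U v w lagBL psiBL cx dx.
  have dA j : cdifferentiable (lrep c (acomp eta c j)) (coord c x).
    apply: csmooth_cdifferentiable (csmooth_acomp eta_smooth eta_base j cx.1) _.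
    by exists x => //; exact: cx.2.
  have PE' : pullback_Om (phi \o eta) c d x v w =
    \sum_k ((\sum_j (dz c j (acomp eta c k) x * dzv v 0 j +
                     dzb c j (acomp eta c k) x * ((dzv v 0 j)^*)%C)) * dzv w 0 k
          - (\sum_j (dz c j (acomp eta c k) x * dzv w 0 j +
                     dzb c j (acomp eta c k) x * ((dzv w 0 j)^*)%C)) * dzv v 0 k).
    by rewrite PE; apply: eq_bigr => k _; rewrite /dv !cD_wirt.
  have := symmetric_part_cancels (s := fun j k => dz c j (acomp eta c k) x)
    (q := fun j k => dzb c j (acomp eta c k) x) (a := dzv v 0) (b := dzv w 0).
  rewrite /= -PE' Im0 => -> //; last first.
    move=> j k; apply: (dz_acomp_sym eta_smooth eta_base j k cx) => i1 i2.
    exact: closed_p.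
  congr (_ * _); apply: eq_bigr => j _; apply: eq_bigr => k _.
  by rewrite (dz_dzb_real eta_smooth eta_base _ _ pK cx).
Qed.
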